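(* Let $N\ge 1$, $M\ge 1$, $1\le Q\le N$ be integers. Consider the channel $$\mathbf{Y}=\mathbf{S}\,\mathbf{P}^{T}\,\mathrm{diag}\{\mathbf{x}\}+\mathbf{W},$$ where $\mathbf{x}\in\mathbb{C}^{N}$ is the input; $\mathbf{S}\in\mathbb{C}^{M\times Q}$ has i.i.d. $\mathcal{CN}(0,1)$ entries; $\mathbf{P}\in\mathbb{C}^{N\times Q}$ is deterministic, of full rank $Q$, and each of its rows has unit Euclidean norm; $\mathbf{W}\in\mathbb{C}^{M\times N}$ has i.i.d. $\mathcal{CN}(0,1)$ entries; and $\mathbf{x}$, $\mathbf{S}$, $\mathbf{W}$ are mutually independent. For $\rho>0$ let $$C(\rho)=\frac{1}{N}\sup I(\mathbf{x};\mathbf{Y}),$$ the supremum being over all distributions of $\mathbf{x}$ satisfying $\mathbb{E}[\|\mathbf{x}\|^{2}]\le N\rho$. Then $$\limsup_{\rho\to\infty}\frac{C(\rho)}{\log\rho}\;\le\;\min\Big\{M\Big(1-\frac{Q}{N}\Big),\;1-\frac{1}{N}\Big\}.$$ *)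

(* Defs.v *)
From HB Require Import structures.
From mathcomp Require Import all_boot all_order all_algebra.
From mathcomp Require Import all_classical all_reals all_analysis.
From mathcomp Require Import complex.

Set Implicit Arguments.
Unset Strict Implicit.
Unset Printing Implicit Defensive.

Import Order.TTheory GRing.Theory Num.Theory.
Local Open Scope classical_set_scope.
Local Open Scope ring_scope.

(** sigma-algebra generated by a family of real random variables (on the
    Borel sets of R); for a complex vector this is sigma(Re/Im of coords),
    i.e. the sigma-algebra generated by the vector itself. *)
Definition gen_sigma {d : measure_display} {T : measurableType d} {R : realType}
  (I : Type) (X : I -> T -> R) : set (set T) :=
  <<s \bigcup_(i in [set: I]) preimage_set_system setT (X i) measurable >>.

Definition mutually_indep {d : measure_display} {T : measurableType d} {R : realType}
  (P : probability T R) (I : finType) (F : I -> set (set T)) : Prop :=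
  forall A : I -> set T, (forall i, F i (A i)) ->
    P (\bigcap_(i in [set: I]) A i) = (\prod_(i : I) P (A i))%E.

Definition fin_partition {d : measure_display} {T : measurableType d}
  (F : set (set T)) (k : nat) (A : 'I_k -> set T) : Prop :=
  [/\ forall i, F (A i),
      forall i j, i != j -> A i `&` A j = set0
    & \bigcup_(i in [set: 'I_k]) A i = setT].

Definition xlogterm {R : realType} (pab pa pb : R) : R :=
  if pab == 0 then 0 else pab * ln (pab / (pa * pb)).

Definition partition_MI {d : measure_display} {T : measurableType d} {R : realType}
  (P : probability T R) (k l : nat) (A : 'I_k -> set T) (B : 'I_l -> set T) : R :=
  \sum_(i < k) \sum_(j < l)
     xlogterm (fine (P (A i `&` B j))) (fine (P (A i))) (fine (P (B j))).

(** mutual information (in nats) between the information carried by the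
    sigma-algebras F and G (Gelfand-Yaglom-Dobrushin definition: supremum
    over finite measurable partitions) *)
Definition mutual_info {d : measure_display} {T : measurableType d} {R : realType}
  (P : probability T R) (F G : set (set T)) : \bar R :=
  ereal_sup [set z | exists (k l : nat) (A : 'I_k -> set T) (B : 'I_l -> set T),
     [/\ fin_partition F A, fin_partition G B & z = (partition_MI P A B)%:E]].

Definition channel_output {T : Type} {R : realType} (N M Q : nat)
  (Pm : 'M[R[i]]_(N, Q))
  (xr xi : 'I_N -> T -> R) (Sr Si : 'I_M -> 'I_Q -> T -> R)
  (Wr Wi : 'I_M -> 'I_N -> T -> R) (m : 'I_M) (n : 'I_N) (t : T) : R[i] :=
  (\sum_(q < Q) (Complex (Sr m q t) (Si m q t)) * Pm n q)
    * Complex (xr n t) (xi n t) + Complex (Wr m n t) (Wi m n t).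

(** X is a real Gaussian with mean 0 and variance 1/2 (real or imaginary
    part of a CN(0,1) variable) *)
Definition half_gauss {d : measure_display} {T : measurableType d} {R : realType}
  (P : probability T R) (X : T -> R) : Prop :=
  measurable_fun setT X /\
  forall A : set R, measurable A ->
    P (X @^-1` A) = normal_prob 0 (Num.sqrt (2^-1 : R)) A.

Definition indep_index (N M Q : nat) : finType :=
  option ((('I_M * 'I_Q) * bool) + (('I_M * 'I_N) * bool)).

Definition admissible {d : measure_display} {T : measurableType d} {R : realType}
  (N M Q : nat) (rho : R) (P : probability T R)
  (xr xi : 'I_N -> T -> R) (Sr Si : 'I_M -> 'I_Q -> T -> R)
  (Wr Wi : 'I_M -> 'I_N -> T -> R) : Prop :=
  [/\ (forall n, measurable_fun setT (xr n) /\ measurable_fun setT (xi n)),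
      (forall m q, half_gauss P (Sr m q) /\ half_gauss P (Si m q)),
      (forall m n, half_gauss P (Wr m n) /\ half_gauss P (Wi m n)),
      mutually_indep P (fun k : indep_index N M Q =>
        match k with
        | None => gen_sigma (fun nb : 'I_N * bool => if nb.2 then xr nb.1 else xi nb.1)
        | Some (inl (mq, b)) =>
            gen_sigma (fun _ : unit => if b then Sr mq.1 mq.2 else Si mq.1 mq.2)
        | Some (inr (mn, b)) =>
            gen_sigma (fun _ : unit => if b then Wr mn.1 mn.2 else Wi mn.1 mn.2)
        end)
    & (\int[P]_t (\sum_(n < N) (xr n t ^+ 2 + xi n t ^+ 2))%:E
         <= (N%:R * rho)%:E)%E].

Definition capacity {R : realType} (N M Q : nat) (Pm : 'M[R[i]]_(N, Q)) (rho : R)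
  : \bar R :=
  ((N%:R^-1 : R)%:E *
   ereal_sup [set z | exists (d : measure_display) (T : measurableType d)
       (P : probability T R) (xr xi : 'I_N -> T -> R)
       (Sr Si : 'I_M -> 'I_Q -> T -> R) (Wr Wi : 'I_M -> 'I_N -> T -> R),
       admissible rho P xr xi Sr Si Wr Wi /\
       z = mutual_info P
             (gen_sigma (fun nb : 'I_N * bool => if nb.2 then xr nb.1 else xi nb.1))
             (gen_sigma (fun mnb : ('I_M * 'I_N) * bool =>
                fun t => let y := channel_output Pm xr xi Sr Si Wr Wi mnb.1.1 mnb.1.2 t in
                         if mnb.2 then complex.Re y else complex.Im y))])%E.

(* Main.v *)
Require Import Defs.
From HB Require Import structures.
From mathcomp Require Import all_boot all_order all_algebra.
From mathcomp Require Import all_classical all_reals all_analysis.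
From mathcomp Require Import complex.
From mathcomp Require Import measurable_realfun ring lra.
Import Order.TTheory GRing.Theory Num.Theory.
Import numFieldNormedType.Exports.
Import ComplexField.Normc.
Local Open Scope classical_set_scope.
Local Open Scope ring_scope.

Set Implicit Arguments.
Unset Strict Implicit.
Unset Printing Implicit Defensive.

(** The mutual information is at most [E (psi x)] as soon as, for every input
    [x], the law of the output given [x] is at most [expR (psi x)] times one
    fixed subprobability [r]. We take for [r] a mixture of the laws of the
    channel itself over a net of inputs, so that [psi x] is the logarithm of
    the size of the net needed at the energy of [x]. No differential entropy
    is needed.

    The law of the output is an image of the standard Gaussian law, and the
    image of that law under a linear map that is bounded together with its
    inverse is at most a constant times a dilation of it. Hence inputs which
    differ by a bounded amount give comparable laws, and so do inputs which
    differ by a scalar of modulus in [[1/2, 1]]. After normalising the largest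
    coordinate to a power of [2], at energy [E] a net therefore has about
    [E ^ (N - 1)] points, which gives the bound [1 - 1/N].

    For the bound [M (1 - Q/N)], choose [Q] linearly independent rows of the
    matrix [P]. Replacing the noise in each of the remaining [N - Q] columns by
    noise of the variance of the signal costs a factor [E ^ (M (N - Q))], and
    then only the dyadic sizes of the coordinates of [x] matter: the size of the
    net is polylogarithmic in [E]. *)

(** * One-dimensional Gaussian integrals *)

(** The obstacle is that rounding the input leaves an error multiplied by the fading matrix [S],
    hence correlated with the signal: it is not additional independent noise. It is removed by a
    substitution: [S] becomes [S A] and [W] becomes [W + S B], a linear map of the pair [(S, W)]
    that is bounded together with its inverse. One net serves all inputs, so the constants of
    domination must be uniform over all such maps. They come from Gaussian elimination with pivots
    bounded below: scalings and shears need only integrals in one variable, and no determinant.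
    Energies are unbounded, so the net is a countable union of levels, mixed with weights
    proportional to [q ^+ k]. As [k] is at most the logarithm of the energy [E] up to a constant,
    these weights cost an extra [E ^ (de / 2)], and powers of [k] cost as much again; both losses
    end up in the [e] of the theorem. The power constraint controls only the mean energy, so
    [ln (1 + E)] is replaced by its tangent at [E = N rho], which is affine in the energy. *)

Definition image_measure d1 d2 (T1 : measurableType d1) (T2 : measurableType d2)
    (R : realType) (m : {measure set T1 -> \bar R}) (f : T1 -> T2)
    (mf : measurable_fun setT f) : {measure set T2 -> \bar R} :=
  measure_function_pushforward__canonical__measure_function_Measure m mf.

Section gauss1.
Context {R : realType}.
Local Notation mu := (@lebesgue_measure R).
Local Notation sg := (Num.sqrt (2^-1 : R)).
Local Notation gam := (normal_prob 0 sg).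

Definition gdens (x : R) : R := normal_pdf 0 sg x.

Lemma gdensE x : gdens x = normal_peak sg * expR (- x ^+ 2).
Proof.
have s0 : sg != 0 by rewrite gt_eqF// sqrtr_gt0 invr_gt0.
rewrite /gdens normal_pdfE// /normal_fun subr0 sqr_sqrtr ?invr_ge0//.
by congr (_ * expR _); rewrite -mulr_natr mulVf// divr1.
Qed.

Lemma gdens_ge0 x : 0 <= gdens x.
Proof. exact: normal_pdf_ge0. Qed.

Lemma measurable_gdens : measurable_fun setT gdens.
Proof. exact: measurable_normal_pdf. Qed.

Import HBNNSimple.

(** Monotone convergence along the same simple functions on both sides leaves indicators, for which
    the identity is the definition of [normal_prob]. *)
Lemma ge0_integral_normal_prob (f : measurableTypeR R -> \bar R) :
  measurable_fun setT f -> (forall x, 0 <= f x)%E ->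
  (\int[gam]_x f x = \int[mu]_x (f x * (gdens x)%:E))%E.
Proof.
move=> mf f0.
have mg : measurable_fun setT (EFin \o gdens).
  by apply/measurable_EFinP; exact: measurable_gdens.
have g0 x : (0 <= (gdens x)%:E)%E by rewrite lee_fin gdens_ge0.
pose f_ := nnsfun_approx measurableT mf.
transitivity (lim (\int[gam]_x (f_ n x)%:E @[n --> \oo])%E).
  rewrite -monotone_convergence//=.
  - apply: eq_integral => ? /[!inE] xD; apply/esym/cvg_lim => //=.
    exact: cvg_nnsfun_approx.
  - move=> n; by apply/measurable_EFinP; exact: measurable_funPT.
  - by move=> n ? _; rewrite lee_fin.
  - by move=> ? _ ? ? mn; rewrite lee_fin; exact/lefP/nd_nnsfun_approx.
rewrite [RHS](_ : _ = lim
    (\int[mu]_x ((f_ n x)%:E * (gdens x)%:E) @[n --> \oo])%E); last first.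
  rewrite -monotone_convergence//=.
  - apply: eq_integral => x _; apply/esym/cvg_lim => //.
    apply: cvgeZr => //; exact: cvg_nnsfun_approx.
  - move=> n; apply: emeasurable_funM => //.
    by apply/measurable_EFinP; exact: measurable_funPT.
  - by move=> n ? _; rewrite mule_ge0// lee_fin.
  - move=> x _ ? ? ?; rewrite lee_wpmul2r// lee_fin.
    exact/lefP/nd_nnsfun_approx.
apply: congr_lim; apply/funext => n /=.
under [LHS]eq_integral do rewrite fimfunE -fsumEFin//.
rewrite ge0_integral_fsum//=; last 2 first.
- move=> r; by apply/measurable_EFinP; apply: measurable_funM => //;
    exact: measurable_indic.
- by move=> r x _; rewrite nnfun_muleindic_ge0.
under [RHS]eq_integral.
  move=> x _; rewrite fimfunE -fsumEFin//.
  rewrite ge0_mule_fsuml; last by move=> r; rewrite nnfun_muleindic_ge0.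
  over.
rewrite ge0_integral_fsum//=; last 2 first.
- move=> r; apply: emeasurable_funM => //.
  by apply/measurable_EFinP; apply: measurable_funM => //;
    exact: measurable_indic.
- by move=> r x _; rewrite mule_ge0// nnfun_muleindic_ge0.
apply: eq_fsbigr => r _.
rewrite integralZl_indic_nnsfun//= integral_indic//= setIT.
have [r0|r0] := ltP r 0.
  rewrite preimage_nnfun0// measure0 mule0.
  by under eq_integral do rewrite indic0 mulr0 mul0e; rewrite integral0.
under eq_integral do rewrite EFinM -muleA.
rewrite ge0_integralZl//; last 2 first.
- apply: emeasurable_funM => //; by apply/measurable_EFinP;
    exact: measurable_indic.
- by move=> x _; rewrite mule_ge0// lee_fin.
congr (_ * _)%E; rewrite /normal_prob [LHS]integral_mkcond/=.
apply: eq_integral => x _; rewrite /patch indicE.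
by case: ifPn => _; rewrite ?mul1e ?mul0e.
Qed.

(** Lebesgue measure is determined by half-open intervals, so it suffices that [|c|] times the image
    measure gives each of them its length. *)
Lemma ge0_integral_affine (f : measurableTypeR R -> \bar R) (c m : R) : c != 0 ->
  measurable_fun setT f -> (forall x, 0 <= f x)%E ->
  (\int[mu]_x f (c * x + m)%R = (`|c|^-1)%:E * \int[mu]_x f x)%E.
Proof.
move=> c0 mf f0.
have c0' : 0 < `|c| by rewrite normr_gt0.
pose phi : measurableTypeR R -> measurableTypeR R := fun x => c * x + m.
have mphi : measurable_fun setT phi.
  by apply: measurable_funD => //; exact: measurable_funM.
have -> : (\int[mu]_x f (c * x + m)%R = \int[pushforward mu phi]_x f x)%E.
  by rewrite ge0_integral_pushforward// preimage_setT.
have c1 : 0 <= `|c|^-1 by rewrite invr_ge0.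
rewrite -(ge0_integral_mscale _ measurableT (NngNum c1))//.
apply: eq_measure_integral => /= A mA _.
change (mu (phi @^-1` A) = ((`|c|^-1)%:E * mu A)%E).
suff -> : mu A = (`|c|%:E * mu (phi @^-1` A))%E.
  by rewrite muleA -EFinM mulVf ?mul1e ?gt_eqF.
pose nu := mscale (NngNum (normr_ge0 c)) (image_measure mu mphi).
have nuE := @lebesgue_measure_unique R nu.
apply: nuE => // _ [[a b]] _ <-.
change (mu `]a, b] = (`|c|%:E * mu (phi @^-1` `]a, b]))%E).
have [cp|cn|] := ltgtP 0 c; last by move/esym/eqP; rewrite (negbTE c0).
- have -> : phi @^-1` `]a, b] = `](a - m) / c, (b - m) / c]%classic.
    apply/seteqP; split => x /=;
      rewrite !in_itv/= /phi ltr_pdivrMr// ler_pdivlMr//;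
    by rewrite ltrBlDr lerBrDr mulrC.
  rewrite !lebesgue_measure_itv/= !lte_fin ltr_pM2r ?invr_gt0// ltrD2r.
  case: ifPn => _; last by rewrite mule0.
  by rewrite -EFinD -EFinM gtr0_norm//; congr _%:E; field; rewrite gt_eqF.
(* A negative slope exchanges the endpoints: the preimage is closed on the left and open on the
   right, with the same length. *)
- have -> : phi @^-1` `]a, b] = `[(b - m) / c, (a - m) / c[%classic.
    apply/seteqP; split => x /=;
      rewrite !in_itv/= /phi ler_ndivrMr// ltr_ndivlMr//;
    by rewrite ltrBlDr lerBrDr mulrC andbC.
  rewrite !lebesgue_measure_itv/= !lte_fin ltr_nM2r ?invr_lt0// ltrD2r.
  case: ifPn => _; last by rewrite mule0.
  by rewrite -EFinD -EFinM ltr0_norm//; congr _%:E; field; rewrite lt_eqF.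
Qed.

Lemma le_gdens x y : x ^+ 2 <= y ^+ 2 -> gdens y <= gdens x.
Proof.
by move=> xy; rewrite !gdensE ler_wpM2l ?normal_peak_ge0// ler_expR lerN2.
Qed.

Lemma ge0_integral_normal_affine (f : measurableTypeR R -> \bar R) (c m : R) :
  c != 0 -> measurable_fun setT f -> (forall x, 0 <= f x)%E ->
  (\int[gam]_x f (c * x + m)%R =
   \int[mu]_x (f x * (`|c|^-1 * gdens ((x - m) / c))%:E))%E.
Proof.
move=> c0 mf f0.
have maff (a b : R) :
    measurable_fun setT (fun x : measurableTypeR R => a * x + b).
  by apply: measurable_funD => //; exact: measurable_funM.
have mfc : measurable_fun setT (fun x : measurableTypeR R => f (c * x + m)%R).
  exact: measurableT_comp.
have mg a b : measurable_fun setT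
    (fun x : measurableTypeR R => (gdens (a * x + b))%:E).
  apply/measurable_EFinP; apply: measurableT_comp => //.
  exact: measurable_gdens.
have mg' : measurable_fun setT
    (fun x : measurableTypeR R => (gdens ((x - m) / c))%:E).
  rewrite (_ : (fun _ => _) = (fun x => (gdens (c^-1 * x + (- m / c)))%:E)) //.
  by apply/funext => x; congr (gdens _)%:E;
    rewrite mulrC mulrBr mulNr [m / c]mulrC.
rewrite ge0_integral_normal_prob//.
have := @ge0_integral_affine
  (fun x => f x * (gdens ((x - m) / c))%:E)%E c m c0.
have -> : (fun x => f (c * x + m)%R * (gdens ((c * x + m - m) / c))%:E)%E =
          (fun x => f (c * x + m)%R * (gdens x)%:E)%E.
  by apply/funext => x; rewrite addrK [c * x]mulrC mulfK.
move=> ->; last 2 first.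
- exact: emeasurable_funM.
- by move=> x; rewrite mule_ge0// lee_fin gdens_ge0.
rewrite -ge0_integralZl//; last 2 first.
- exact: emeasurable_funM.
- by move=> x _; rewrite mule_ge0// lee_fin gdens_ge0.
by apply: eq_integral => x _; rewrite EFinM muleCA.
Qed.

(** A narrow centred Gaussian density lies below a wider one times the ratio of the widths: the
    exponential factor grows with the width, and [k / |c|] is the ratio of the peaks. *)
Lemma integral_normal_scale (f : measurableTypeR R -> \bar R) (c k : R) :
  0 < `|c| <= k -> measurable_fun setT f -> (forall x, 0 <= f x)%E ->
  (\int[gam]_x f (c * x)%R <= (k / `|c|)%:E * \int[gam]_x f (k * x)%R)%E.
Proof.
move=> /andP[c0 ck] mf f0.
have k0 : 0 < k by exact: lt_le_trans ck.
have mg (a : R) : measurable_fun setT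
    (fun x : measurableTypeR R => (gdens (x / a))%:E).
  apply/measurable_EFinP; apply: measurableT_comp; first exact: measurable_gdens.
  exact: measurable_funM.
have E (a : R) : a != 0 -> (\int[gam]_x f (a * x)%R =
    \int[mu]_x (f x * (`|a|^-1 * gdens (x / a))%:E))%E.
  move=> a0; under eq_integral do rewrite -[X in f X]addr0.
  rewrite (ge0_integral_normal_affine 0 a0 mf f0).
  by apply: eq_integral => x _; rewrite subr0.
have m2 (a : R) : measurable_fun setT (fun x : measurableTypeR R =>
    f x * (`|a|^-1 * gdens (x / a))%:E)%E.
  apply: emeasurable_funM => //.
  by under eq_fun do rewrite EFinM; apply: emeasurable_funM.
have p2 (a x : R) : (0 <= f x * (`|a|^-1 * gdens (x / a))%:E)%E.
  by rewrite mule_ge0// lee_fin mulr_ge0 ?gdens_ge0 ?invr_ge0.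
have cn0 : c != 0 by rewrite -normr_gt0.
rewrite (E _ cn0) (E k) ?gt_eqF//.
rewrite -ge0_integralZl//; last by rewrite lee_fin divr_ge0// ltW.
apply: ge0_le_integral => //.
  by apply: measurable_funeM.
move=> x _; rewrite muleCA lee_wpmul2l// -EFinM lee_fin (gtr0_norm k0).
have -> : k / `|c| * (k^-1 * gdens (x / k)) = `|c|^-1 * gdens (x / k).
  by rewrite mulrA [k / _ / k]mulrAC divff ?gt_eqF// mul1r.
rewrite ler_wpM2l ?invr_ge0//.
apply: le_gdens; rewrite !expr_div_n ler_wpM2l ?sqr_ge0//.
have c2 : c ^+ 2 = `|c| ^+ 2 by rewrite real_normK// num_real.
by rewrite c2 lef_pV2 ?posrE ?exprn_gt0// ler_pXn2r// nnegrE ltW.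
Qed.

(* Completing the square: a shear of bounded slope changes the quadratic form
   [u ^+ 2 + v ^+ 2] by a bounded factor only. *)
Lemma gdens_shear (b be u v : R) : `|b| <= be ->
  gdens v * gdens (u - b * v) <=
  gdens (v / (2 + 2 * be)) * gdens (u / (2 + 2 * be)).
Proof.
move=> bbe; rewrite !gdensE.
have be0 : 0 <= be by exact: le_trans bbe.
rewrite mulrACA [leRHS]mulrACA ler_wpM2l ?mulr_ge0 ?normal_peak_ge0//.
rewrite -!expRD ler_expR -!opprD lerN2 !expr_div_n -mulrDl.
rewrite ler_pdivrMr; last by rewrite exprn_gt0//; lra.
have b2 : b ^+ 2 <= be ^+ 2.
  by rewrite -(real_normK (num_real b)) ler_pXn2r// nnegrE.
(* From [u = w + b * v] with [w = u - b * v]. Then [u ^+ 2 + v ^+ 2] is at most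
   [2 * w ^+ 2 + (1 + 2 * be ^+ 2) * v ^+ 2], and [(2 + 2 * be) ^+ 2] exceeds both coefficients. *)
have h1 : u ^+ 2 <= 2 * (u - b * v) ^+ 2 + 2 * be ^+ 2 * v ^+ 2.
  apply: (@le_trans _ _ (2 * (u - b * v) ^+ 2 + 2 * b ^+ 2 * v ^+ 2)).
    by have := sqr_ge0 (u - 2 * (b * v)); nra.
  by rewrite lerD2l ler_wpM2r ?sqr_ge0// ler_wpM2l.
have p1 := sqr_ge0 v; have p2 := sqr_ge0 (u - b * v).
have : 0 <= be * v ^+ 2 by rewrite mulr_ge0.
have : 0 <= be ^+ 2 * v ^+ 2 by rewrite mulr_ge0// sqr_ge0.
have : 0 <= be * (u - b * v) ^+ 2 by rewrite mulr_ge0.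
have : 0 <= be ^+ 2 * (u - b * v) ^+ 2 by rewrite mulr_ge0// sqr_ge0.
move: h1 p1 p2; move: (u - b * v) => w.
move: (v ^+ 2) (w ^+ 2) (u ^+ 2) => V W U; nra.
Qed.

(** A shear preserves area, so once both sides are written with densities [gdens_shear] compares
    them pointwise; the factor [(2 + 2 * be) ^+ 2] is the Jacobian of the planar dilation. *)
Lemma integral_normal_shear
    (f : measurableTypeR R * measurableTypeR R -> \bar R) (b be : R) :
  `|b| <= be -> measurable_fun setT f -> (forall x, 0 <= f x)%E ->
  (\int[gam]_v \int[gam]_u f ((u + b * v)%R, v) <=
   ((2 + 2 * be) ^+ 2)%:E *
   \int[gam]_v \int[gam]_u f (((2 + 2 * be) * u)%R, ((2 + 2 * be) * v)%R))%E.
Proof.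
move=> bbe mf f0; set k := 2 + 2 * be.
have be0 : 0 <= be by exact: le_trans bbe.
have k0 : 0 < k by rewrite /k; lra.
have kn0 : k != 0 by rewrite gt_eqF.
have mfv (v : R) : measurable_fun setT
   (fun u : measurableTypeR R => f (u, v)).
  by apply: measurableT_comp.
have sec (c m v : R) : c != 0 -> (\int[gam]_u f ((c * u + m)%R, v) =
    \int[mu]_u (f (u, v) * (`|c|^-1 * gdens ((u - m) / c))%:E))%E.
  by move=> c0; rewrite (@ge0_integral_normal_affine (fun u => f (u, v))).
have -> : (\int[gam]_v \int[gam]_u f ((u + b * v)%R, v) =
   \int[gam]_v \int[mu]_u (f (u, v) * (gdens (u - b * v))%:E))%E.
  apply: eq_integral => v _; rewrite -[RHS]/(_).
  transitivity (\int[gam]_u f ((1 * u + b * v)%R, v))%E.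
    by apply: eq_integral => u _; rewrite mul1r.
  rewrite sec ?oner_neq0//; apply: eq_integral => u _.
  by rewrite normr1 !invr1 mul1r mulr1.
have -> : (\int[gam]_v \int[gam]_u f ((k * u)%R, (k * v)%R) =
   \int[gam]_v \int[mu]_u (f (u, (k * v)%R) * (k^-1 * gdens (u / k))%:E))%E.
  apply: eq_integral => v _.
  transitivity (\int[gam]_u f ((k * u + 0)%R, (k * v)%R))%E.
    by apply: eq_integral => u _; rewrite addr0.
  rewrite (sec _ _ _ kn0); apply: eq_integral => u _.
  by rewrite subr0 gtr0_norm.
have mg (a c e : R) : measurable_fun setT
    (fun z : measurableTypeR R * measurableTypeR R =>
       f (z.2, z.1) * (c * gdens (a * z.2 + e * z.1))%:E)%E.
  apply: emeasurable_funM.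
    by apply: measurableT_comp => //; exact: measurable_swap.
  apply/measurable_EFinP; apply: measurable_funM => //.
  apply: measurableT_comp; first exact: measurable_gdens.
  by apply: measurable_funD; apply: measurable_funM.
pose F a c e (z : measurableTypeR R * measurableTypeR R) :=
  (f (z.2, z.1) * (c * gdens (a * z.2 + e * z.1))%:E)%E.
have F0 a c e z : 0 <= c -> (0 <= F a c e z)%E.
  by move=> c0; rewrite /F mule_ge0// lee_fin mulr_ge0// gdens_ge0.
have mH a c e : 0 <= c ->
    measurable_fun setT (fun v => \int[mu]_u F a c e (v, u))%E.
  move=> c0; apply: (@measurable_fun_fubini_tonelli_F _ _ _ _ _ mu).
    exact: mg.
  by move=> z; exact: F0.
have mFv a c e v : measurable_fun setT (fun u => F a c e (v, u)).
  by apply: measurableT_comp => //; exact: mg.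
have k0' : 0 <= k^-1 by rewrite invr_ge0 ltW.
rewrite [X in (X <= _)%E](_ :
  (_ = \int[gam]_v \int[mu]_u F 1%R 1%R (- b)%R (v, u))%E);
  last first.
  apply: eq_integral => v _; apply: eq_integral => u _.
  by rewrite /F /= !mul1r mulNr.
rewrite [X in (_ <= _ * X)%E](_ :
  (_ = \int[gam]_v \int[mu]_u F k^-1%R k^-1%R 0%R ((k * v)%R, u))%E);
  last first.
  apply: eq_integral => v _; apply: eq_integral => u _.
  rewrite /F /=; congr (_ * (_ * gdens _)%:E)%E.
  by rewrite mul0r addr0 mulrC.
rewrite [leLHS](@ge0_integral_normal_prob
  (fun v => \int[mu]_u F 1%R 1%R (- b)%R (v, u))%E); last 2 first.
- exact: mH.
- by move=> v; apply: integral_ge0 => u _; exact: F0.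
pose G (v : measurableTypeR R) := (\int[mu]_u F k^-1%R k^-1%R 0%R (v, u))%E.
have G0 v : (0 <= G v)%E by apply: integral_ge0 => u _; exact: F0.
have mG : measurable_fun setT G by exact: mH.
have EG : (\int[gam]_v G (k * v)%R =
    \int[mu]_v (G v * (k^-1 * gdens (v / k))%:E))%E.
  transitivity (\int[gam]_v G (k * v + 0)%R)%E.
    by apply: eq_integral => v _; rewrite addr0.
  rewrite (ge0_integral_normal_affine 0 kn0 mG G0); apply: eq_integral => v _.
  by rewrite subr0 gtr0_norm.
rewrite -/(G _) [X in (_ <= _ * X)%E]EG.
have mgd (a c : R) :
    measurable_fun setT (fun v : measurableTypeR R => (c * gdens (v / a))%:E).
  apply/measurable_EFinP; apply: measurable_funM => //.
  apply: measurableT_comp; first exact: measurable_gdens.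
  exact: measurable_funM.
have mGg : measurable_fun setT (fun v => G v * (k^-1 * gdens (v / k))%:E)%E.
  exact: emeasurable_funM.
have Gg0 v : (0 <= G v * (k^-1 * gdens (v / k))%:E)%E.
  by rewrite mule_ge0// lee_fin mulr_ge0 ?gdens_ge0.
have k2 : (0 <= (k ^+ 2)%:E)%E by rewrite lee_fin sqr_ge0.
rewrite -(ge0_integralZl mu measurableT mGg (fun v _ => Gg0 v) k2).
apply: ge0_le_integral => //.
- move=> v _; rewrite mule_ge0 ?lee_fin ?gdens_ge0//.
  by apply: integral_ge0 => u _; exact: F0.
- apply: emeasurable_funM; first exact: mH.
  by apply/measurable_EFinP; exact: measurable_gdens.
- exact: measurable_funeM.
move=> v _.
have comm (A B : \bar R) (p q r : R) : (p%:E * A <= (q * r)%:E * B)%E ->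
    (A * p%:E <= q%:E * (B * r%:E))%E.
  by rewrite EFinM -muleA (muleC r%:E) (muleC p%:E).
apply: comm; rewrite /G.
have gv0 : (0 <= (gdens v)%:E)%E by rewrite lee_fin gdens_ge0.
have gk0 : (0 <= (k ^+ 2 * (k^-1 * gdens (v / k)))%:E)%E.
  by rewrite lee_fin mulr_ge0 ?sqr_ge0// mulr_ge0// gdens_ge0.
rewrite -(ge0_integralZl mu measurableT (mFv 1 1 (- b) v) _ gv0); last first.
  by move=> u _; exact: F0.
rewrite -(ge0_integralZl mu measurableT (mFv k^-1 k^-1 0 v) _ gk0); last first.
  by move=> u _; exact: F0.
apply: ge0_le_integral => //.
- by move=> u _; rewrite mule_ge0 ?F0// lee_fin gdens_ge0.
- exact: measurable_funeM.
- exact: measurable_funeM.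
move=> u _; rewrite /F /= !(muleCA _ (f (u, v))) lee_wpmul2l//.
rewrite -!EFinM lee_fin !mul1r mulNr mul0r addr0.
apply: le_trans (gdens_shear u v bbe) _; rewrite -/k.
rewrite le_eqVlt; apply/orP; left; apply/eqP; rewrite [k^-1 * u]mulrC.
by move: (gdens _) (gdens _) => p q; field.
Qed.
End gauss1.

(** * Gaussian vectors *)

Section vec.
Context {R : realType}.

Definition coord_sets (I : Type) : set (set (I -> R)) :=
  \bigcup_(i in [set: I]) preimage_set_system setT (fun v :
    I -> R => v i) measurable.

Definition vec (I : Type) := g_sigma_algebraType (@coord_sets I).

Lemma measurable_coord (I : Type) (i : I) :
  measurable_fun setT (fun v : vec I => v i).
Proof.
by move=> _ A mA; apply: sub_sigma_algebra; exists i => //; exists A.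
Qed.

Lemma measurable_vecP d (T : measurableType d) (I : Type) (f : T -> vec I) :
  (forall i, measurable_fun setT (fun t => f t i)) -> measurable_fun setT f.
Proof.
move=> mf; refine (@measurability _ _ T (vec I) setT f (@coord_sets I) erefl _).
move=> _ [_ [i _ [A mA <-]] <-]; rewrite !setTI.
by rewrite -[X in measurable X]setTI; exact: mf.
Qed.

(** Pulling back all coordinates amounts to pulling back along one map into [vec]; the
    sigma-algebras of the problem thereby become those of random vectors. *)
Lemma gen_sigmaE d (T : measurableType d) (I : Type) (X : I -> T -> R) :
  gen_sigma X =
  preimage_set_system setT (fun t => X^~ t : vec I) (@measurable _ (vec I)).
Proof.
pose f (t : T) : vec I := X^~ t.
rewrite -[RHS](g_sigma_preimageE _ f (@coord_sets I)).
congr (smallest _ _); apply/seteqP; split => A.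
  move=> [i _ [C mC <-]]; exists [set v : I -> R | C (v i)] => //.
  by exists i => //; exists C => //; rewrite setTI.
move=> [_ [i _ [C mC <-]] <-]; exists i => //; exists C => //.
by rewrite !setTI.
Qed.

Definition box (I : Type) (A : I -> set R) : set (vec I) :=
  [set v | forall i, A i (v i)].

Definition boxes (I : Type) : set (set (vec I)) :=
  [set B | exists2 A : I -> set R, (forall i, measurable (A i)) & B = box A].

Lemma boxT (I : Type) : box (fun _ : I => setT) = setT.
Proof. by apply/seteqP; split. Qed.

Lemma measurable_box (I : finType) (A : I -> set R) :
  (forall i, measurable (A i)) -> measurable (box A : set (vec I)).
Proof.
move=> mA; rewrite (_ : box A = \big[setI/setT]_(i :
  I) ((fun v => v i) @^-1` A i)).
  apply: bigsetI_measurable => i _; rewrite -[X in measurable X]setTI.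
  exact: measurable_coord.
rewrite -bigcap_seq; apply/seteqP; split => v /=.
  by move=> Av i _; exact: Av.
by move=> Av i; apply: Av; rewrite /= mem_index_enum.
Qed.

Lemma boxes_setI (I : Type) : setI_closed (@boxes I).
Proof.
move=> _ _ [A mA ->] [B mB ->]; exists (fun i => A i `&` B i).
  by move=> i; exact: measurableI.
by apply/seteqP; split => v /=; [move=> [Av Bv] i; split|move=> AB; split=> i;
  case: (AB i)].
Qed.

Lemma measurable_boxesE (I : finType) :
  @measurable _ (vec I) = <<s @boxes I >>.
Proof.
apply/seteqP; split; last first.
  apply: smallest_sub; first exact: sigma_algebra_measurable.
  by move=> _ [A mA ->]; exact: measurable_box.
apply: (@smallest_sub _ (sigma_algebra setT) (@coord_sets I)).
  exact: smallest_sigma_algebra.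
move=> _ [i _ [C mC <-]]; apply: sub_sigma_algebra.
exists (fun k => if k == i then C else setT).
  by move=> k; case: ifP.
rewrite setTI; apply/seteqP; split => v /=.
  by move=> Cv k /=; case: eqP => // ->.
by move=> /(_ i) /=; rewrite eqxx.
Qed.

Lemma box_measure_unique (I : finType)
    (m1 m2 : {measure set (vec I) -> \bar R}) :
  (m1 setT < +oo)%E ->
  (forall A, (forall i, measurable (A i)) -> m1 (box A) = m2 (box A)) ->
  forall B, measurable B -> m1 B = m2 B.
Proof.
move=> foo m12 B mB.
apply: (measure_unique (@boxes I) (fun _ => setT)) => //.
- exact: measurable_boxesE.
- exact: boxes_setI.
- by move=> _; exists (fun=> setT) => //; rewrite boxT.
- by rewrite bigcup_const.
- by move=> _ [A mA ->]; exact: m12.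
Qed.

Local Notation gam := (normal_prob 0 (Num.sqrt (2^-1 : R))).

(** The law is characterised on boxes rather than constructed: it will be instantiated by the
    distribution of the noise of a given channel. *)
Definition gaussian (I : finType) (g : probability (vec I) R) :=
  forall A : I -> set R, (forall i, measurable (A i)) ->
    g (box A) = (\prod_(i : I) gam (A i))%E.

Definition upd (I : eqType) (v : I -> R) (i : I) (u : R) : I -> R :=
  fun k => if k == i then u else v k.

Lemma measurable_upd (I : eqType) (i : I) :
  measurable_fun setT (fun z : vec I * measurableTypeR R => upd z.1 i z.2 :
    vec I).
Proof.
apply: measurable_vecP => k; rewrite /upd; case: (k == i).
  exact: measurable_snd.
exact: (measurableT_comp (@measurable_coord I k) measurable_fst).
Qed.

(** Redrawing one coordinate independently leaves the measure of every box unchanged. This exposes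
    one Gaussian variable at a time to the one-dimensional estimates. *)
Lemma gaussian_resample (I : finType) (g : probability (vec I) R) (i : I)
    (f : vec I -> \bar R) : gaussian g ->
  measurable_fun setT f -> (forall v, 0 <= f v)%E ->
  (\int[g]_v f v = \int[g]_v \int[gam]_u f (upd v i u))%E.
Proof.
move=> gg mf f0.
have mu1 := @measurable_upd I i.
transitivity (\int[g \x gam]_z f (upd z.1 i z.2))%E; last first.
  rewrite (@fubini_tonelli1 _ _ _ _ _ g gam
    (fun z : vec I * measurableTypeR R => f (upd z.1 i z.2)))//.
  exact: (measurableT_comp mf mu1).
rewrite -[RHS](@ge0_integral_pushforward _ _ _ (vec I) _ _ mu1 _ setT f)//.
  apply: eq_measure_integral => B mB _.
  apply: (@box_measure_unique I g (image_measure (g \x gam)%E mu1)) => //.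
    exact: (le_lt_trans (probability_le1 g measurableT) (ltry _)).
  move=> A mA; transitivity (\prod_(j : I) gam (A j))%E; first exact: gg.
  change (\prod_(j : I) gam (A j) =
    (g \x gam) ((fun z : vec I * measurableTypeR R =>
      upd z.1 i z.2) @^-1` box A))%E.
  (* The old value at [i] is overwritten by [upd], so that side of the box is relaxed to the whole
     line. *)
  pose A' k := if k == i then setT else A k.
  have mA' k : measurable (A' k) by rewrite /A'; case: ifP.
  have -> : (fun z : vec I * measurableTypeR R => upd z.1 i z.2) @^-1` box A =
      box A' `*` A i.
    apply/seteqP; split => -[v u] /=.
      move=> Avu; split.
        by move=> k; rewrite /A'; case: eqP => // ki; have := Avu k;
          rewrite /upd /=; case: eqP.
      by have := Avu i; rewrite /upd /= eqxx.
    by move=> [Av Au] k; rewrite /upd /=; case: eqP => [->//|/eqP ki];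
      have := Av k; rewrite /A' (negbTE ki).
  have mbA' : measurable (box A' : set (vec I)) by exact: measurable_box.
  rewrite product_measure1E//; last exact: mA.
  transitivity ((\prod_(k : I) gam (A' k)) * gam (A i))%E;
    last by congr (_ * _)%E; exact/esym/gg.
  rewrite (bigD1 i)//= [in RHS](bigD1 i)//=.
  have -> : A' i = setT by rewrite /A' eqxx.
  rewrite probability_setT mul1e muleC.
  by congr (_ * _)%E; apply: eq_bigr => k ki; rewrite /A' (negbTE ki).
Qed.

Lemma gaussian_resample2 (I : finType) (g : probability (vec I) R) (i j : I)
    (f : vec I -> \bar R) : gaussian g ->
  measurable_fun setT f -> (forall v, 0 <= f v)%E ->
  (\int[g]_v f v =
   \int[g]_z \int[gam]_v \int[gam]_u f (upd (upd z j v) i u))%E.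
Proof.
move=> gg mf f0; rewrite (gaussian_resample i gg)//.
rewrite (@gaussian_resample I g j (fun z => \int[gam]_u f (upd z i u))%E gg)//.
- apply: (@measurable_fun_fubini_tonelli_F _ _ _ _ _ gam
    (fun z : vec I * measurableTypeR R => f (upd z.1 i z.2))).
    exact: (measurableT_comp mf (@measurable_upd I i)).
  by move=> z; exact: f0.
- by move=> v; exact: integral_ge0.
Qed.

Lemma gaussian_scale1 (I : finType) (g : probability (vec I) R) (i : I)
    (f : vec I -> \bar R) (c k : R) : gaussian g -> 0 < `|c| <= k ->
  measurable_fun setT f -> (forall v, 0 <= f v)%E ->
  (\int[g]_v f (upd v i (c * v i)%R) <=
   (k / `|c|)%:E * \int[g]_v f (upd v i (k * v i)%R))%E.
Proof.
move=> gg ck mf f0.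
have m1 (a : R) : measurable_fun setT (fun v : vec I => f (upd v i (a * v i))).
  apply: (measurableT_comp mf); apply: measurable_vecP => l.
  rewrite /upd; case: (l == i); last exact: measurable_coord.
  by apply: measurable_funM => //; exact: measurable_coord.
have E (a : R) : (\int[g]_v f (upd v i (a * v i)%R) =
    \int[g]_v \int[gam]_u f (upd v i (a * u)%R))%E.
  rewrite (@gaussian_resample I g i _ gg (m1 a))//.
  apply: eq_integral => v _; apply: eq_integral => u _; congr f.
  by apply/funext => l; rewrite /upd eqxx; case: (l == i).
have m2 (a : R) : measurable_fun setT
    (fun z : vec I * measurableTypeR R => f (upd z.1 i (a * z.2))).
  apply: (measurableT_comp mf).
  apply: (measurableT_comp (measurable_upd i) (_ : measurable_fun setT
    (fun z : vec I * measurableTypeR R => (z.1, (a * z.2)%R :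
      measurableTypeR R)))).
  apply/measurable_fun_pairP; split => /=; first exact: measurable_fst.
  by apply: measurable_funM.
have m3 (a : R) : measurable_fun setT
    (fun v : vec I => \int[gam]_u f (upd v i (a * u)%R))%E.
  apply: (@measurable_fun_fubini_tonelli_F _ _ _ _ _ gam
    (fun z : vec I * measurableTypeR R => f (upd z.1 i (a * z.2)%R))) => //.
have k0 : 0 < k by case/andP: ck => ?; exact: lt_le_trans.
rewrite !E -ge0_integralZl//; last 2 first.
- by move=> v _; apply: integral_ge0.
- by rewrite lee_fin divr_ge0// ltW.
apply: ge0_le_integral => //.
- by move=> v _; exact: integral_ge0.
- exact: measurable_funeM.
move=> v _; apply: (@integral_normal_scale R (fun u => f (upd v i u))) => //.
apply: (measurableT_comp mf); apply: measurable_vecP => l.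
by rewrite /upd; case: (l == i).
Qed.

Lemma gaussian_shear (I : finType) (g : probability (vec I) R) (i j : I)
    (f : vec I -> \bar R) (b be : R) : gaussian g -> i != j -> `|b| <= be ->
  measurable_fun setT f -> (forall v, 0 <= f v)%E ->
  (\int[g]_v f (upd v i (v i + b * v j)%R) <=
   ((2 + 2 * be) ^+ 2)%:E * \int[g]_v f (upd (upd v j ((2 + 2 * be) * v j))
     i ((2 + 2 * be) * v i)%R))%E.
Proof.
move=> gg ij bbe mf f0; set k := 2 + 2 * be.
have be0 : 0 <= be by exact: le_trans bbe.
have mij (a c e : R) : measurable_fun setT (fun v : vec I =>
    upd (upd v j (e * v j)) i (a * v i + c * v j) : vec I).
  apply: measurable_vecP => l; rewrite /upd; case: (l == i).
    by apply: measurable_funD; apply: measurable_funM => //;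
      exact: measurable_coord.
  case: (l == j); last exact: measurable_coord.
  by apply: measurable_funM => //; exact: measurable_coord.
(* One family holds both maps: [S 1 b 1] is the shear and [S k 0 k] the dilation of the two
   coordinates, so the redrawing is done once. *)
pose S a c e (v : vec I) : vec I := upd (upd v j (e * v j)) i (a * v i + c * v j).
have mS a c e : measurable_fun setT (fun v => f (S a c e v)).
  exact: (measurableT_comp mf (mij a c e)).
have SE a c e z v u : S a c e (upd (upd z j v) i u) =
    upd (upd z j (e * v)) i (a * u + c * v).
  apply/funext => l; rewrite /S /upd !eqxx [j == i]eq_sym (negbTE ij).
  by case: (l == i) => //; case: (l == j).
pose F z (w : measurableTypeR R * measurableTypeR R) :=
  f (upd (upd z j w.2) i w.1).
have mF : measurable_fun setT (fun z :
  vec I * measurableTypeR R * measurableTypeR R =>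
    upd (upd z.1.1 j z.1.2) i z.2 : vec I).
  apply: measurable_vecP => l; rewrite /upd; case: (l == i);
    first exact: measurable_snd.
  case: (l == j); first exact: (measurableT_comp measurable_snd measurable_fst).
  exact: (measurableT_comp (@measurable_coord I l)
    (measurableT_comp measurable_fst measurable_fst)).
have mFz z : measurable_fun setT (F z).
  apply: (measurableT_comp mf); apply: measurable_vecP => l; rewrite /upd.
  by case: (l == i); [exact: measurable_fst|case: (l == j) => //;
    exact: measurable_snd].
have E a c e : (\int[g]_v f (S a c e v) =
    \int[g]_z \int[gam]_v \int[gam]_u F z ((a * u + c * v)%R, (e * v)%R))%E.
  rewrite (@gaussian_resample2 I g i j _ gg (mS a c e) (fun _ => f0 _)).
  apply: eq_integral => z _; apply: eq_integral => v _; apply: eq_integral => u _.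
  by rewrite SE.
have mI a c e : measurable_fun setT
   (fun z : vec I => \int[gam]_v \int[gam]_u F z ((a * u + c * v)%R, (e * v)%R))%E.
  apply: (@measurable_fun_fubini_tonelli_F _ _ _ _ _ gam
    (fun z : vec I * measurableTypeR R =>
       \int[gam]_u F z.1 ((a * u + c * z.2)%R, (e * z.2)%R))%E); last first.
    by move=> z; apply: integral_ge0 => u _; exact: f0.
  apply: (@measurable_fun_fubini_tonelli_F _ _ _ _ _ gam
    (fun z : vec I * measurableTypeR R * measurableTypeR R =>
       F z.1.1 ((a * z.2 + c * z.1.2)%R, (e * z.1.2)%R))%E); last first.
    by move=> z; exact: f0.
  apply: (measurableT_comp mf); apply: measurable_vecP => l; rewrite /upd /=.
  have m12 : measurable_fun setT
      (fun z : vec I * measurableTypeR R * measurableTypeR R => z.1.2).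
    exact: (measurableT_comp measurable_snd measurable_fst).
  case: (l == i).
    by apply: measurable_funD; apply: measurable_funM.
  case: (l == j); first by apply: measurable_funM.
  exact: (measurableT_comp (@measurable_coord I l)
    (measurableT_comp measurable_fst measurable_fst)).
have L1 : (\int[g]_v f (upd v i (v i + b * v j)%R) =
  \int[g]_v f (S 1%R b 1%R v))%E.
  apply: eq_integral => v _; congr f; apply/funext => l; rewrite /S /upd !mul1r.
  by case: (l == i) => //; case: eqP => // ->.
have L2 : (\int[g]_v f (upd (upd v j (k * v j)) i (k * v i))%R =
    \int[g]_v f (S k 0%R k v))%E.
  apply: eq_integral => v _; congr f; apply/funext => l.
  by rewrite /S /upd mul0r addr0.
rewrite [leLHS]L1 [X in (_ <= _ * X)%E]L2.
rewrite (E 1 b 1) (E k 0 k) -ge0_integralZl//; last 2 first.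
- by move=> z _; do 2 (apply: integral_ge0 => ? _); exact: f0.
- by rewrite lee_fin sqr_ge0.
apply: ge0_le_integral => //.
- by move=> z _; do 2 (apply: integral_ge0 => ? _); exact: f0.
- exact: measurable_funeM.
move=> z _.
have K1 : (\int[gam]_v \int[gam]_u F z ((1 * u + b * v)%R, (1 * v)%R) =
    \int[gam]_v \int[gam]_u F z ((u + b * v)%R, v))%E.
  by do 2 (apply: eq_integral => ? _); rewrite !mul1r.
have K2 : (\int[gam]_v \int[gam]_u F z ((k * u + 0 * v)%R, (k * v)%R) =
    \int[gam]_v \int[gam]_u F z ((k * u)%R, (k * v)%R))%E.
  by do 2 (apply: eq_integral => ? _); rewrite mul0r addr0.
rewrite [leLHS]K1 [X in (_ <= _ * X)%E]K2.
exact: (@integral_normal_shear R (F z) b be bbe (mFz z) (fun _ => f0 _)).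
Qed.

(** One coordinate at a time, with [c = 1] in [gaussian_scale1]: widening a variable costs the ratio
    of the widths. *)
Lemma gaussian_upscale (I : finType) (g : probability (vec I) R)
    (f : vec I -> \bar R) (s : I -> R) : gaussian g -> (forall i, 1 <= s i) ->
  measurable_fun setT f -> (forall v, 0 <= f v)%E ->
  (\int[g]_v f v <=
   (\prod_i s i)%:E * \int[g]_v f (fun i => s i * v i)%R)%E.
Proof.
move=> gg s1 mf f0.
have mdiag (r : seq I) : measurable_fun setT
    (fun v : vec I => (fun i => if i \in r then s i * v i else v i) : vec I).
  apply: measurable_vecP => i; case: (i \in r); last exact: measurable_coord.
  by apply: measurable_funM => //; exact: measurable_coord.
suff H (r : seq I) : uniq r -> (\int[g]_v f v <= (\prod_(i <- r) s i)%:E *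
    \int[g]_v f (fun i => if i \in r then s i * v i else v i)%R)%E.
  apply: (le_trans (H (index_enum I) (index_enum_uniq I))).
  rewrite le_eqVlt; apply/orP; left; apply/eqP.
  congr (_ * _)%E; apply: eq_integral => v _; congr f.
  by apply/funext => i; rewrite mem_index_enum.
elim: r => [_|i r IH /= /andP[ir ur]].
  by rewrite big_nil mul1e.
apply: (le_trans (IH ur)).
rewrite big_cons [s i * _]mulrC EFinM -muleA lee_wpmul2l//.
  by rewrite lee_fin prodr_ge0// => j _; exact: le_trans (s1 j).
have s0 : 0 < s i by exact: lt_le_trans (s1 i).
pose h v := f (fun j => if j \in r then s j * v j else v j).
have s1' : 0 < `|1 : R| <= s i by rewrite normr1 ltr01 s1.
have := @gaussian_scale1 I g i h 1 (s i) gg s1' (measurableT_comp mf (mdiag r))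
  (fun _ => f0 _).
have -> : (\int[g]_v h (upd v i (1 * v i)%R) = \int[g]_v h v)%E.
  apply: eq_integral => v _; congr h; apply/funext => j.
  by rewrite /upd mul1r; case: eqP => [->|].
rewrite normr1 divr1 => hs; apply: (le_trans hs).
rewrite le_eqVlt; apply/orP; left; apply/eqP.
congr (_ * _)%E; apply: eq_integral => v _; congr f; apply/funext => j.
by rewrite /upd in_cons; case: eqP => [->|//]; rewrite (negbTE ir).
Qed.

End vec.
Arguments vec : clear implicits.

(** * Images of the Gaussian law under linear maps *)

Section domination.
Context {R : realType} {I : finType}.
Local Notation V := (vec R I).
Implicit Types (T : V -> V) (v : V) (K k : R).

Definition linop T := forall (a : R) (u v : V),
  T (fun l => a * u l + v l) = fun l => a * T u l + T v l.

Definition opbound (be : R) T := forall (r : R) v, (forall l, `|v l| <= r) ->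
  forall l, `|T v l| <= be * r.

Definition unitv (i : I) : V := fun l => (l == i)%:R.

(** The target is a dilation because [T] may stretch: its image law then has heavier tails than the
    Gaussian law, and no multiple of the latter bounds it. *)
Definition dom K k T := forall (g : probability V R) (f : V -> \bar R),
  gaussian g -> measurable_fun setT f -> (forall v, 0 <= f v)%E ->
  (\int[g]_v f (T v) <= K%:E * \int[g]_v f (fun l => k * v l)%R)%E.

Lemma linopZ T a v : linop T -> T (fun l => a * v l) = fun l => a * T v l.
Proof.
move=> lT; have h0 : T (fun=> 0) = fun=> 0.
  have := lT (-1) (fun=> 0) (fun=> 0).
  rewrite (_ : (fun l => _) = fun=> 0); last by apply/funext => l;
    rewrite mulr0 addr0.
  by move=> {1}->; apply/funext => l; rewrite mulN1r addNr.
have := lT a v (fun=> 0); rewrite h0.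
rewrite (_ : (fun l => _) = fun l => a * v l).
  by move=> ->; apply/funext => l; rewrite addr0.
by apply/funext => l; rewrite addr0.
Qed.

Lemma linop_sum T (J : Type) (r : seq J) (a : J -> R) (F : J -> V) : linop T ->
  T (fun l => \sum_(j <- r) a j * F j l) = fun l => \sum_(j <- r) a j * T (F j) l.
Proof.
move=> lT; elim: r => [|j r IH].
  have /= := linopZ 0 (fun=> 0) lT.
  rewrite (_ : (fun l => _) = fun l : I => \sum_(j <- [::]) a j * F j l).
    by move=> ->; apply/funext => l; rewrite mul0r big_nil.
  by apply/funext => l; rewrite mul0r big_nil.
rewrite (_ : (fun l => _) = fun l : I => a j * F j l + \sum_(j <- r) a j * F j l).
  by rewrite lT IH; apply/funext => l; rewrite big_cons.
by apply/funext => l; rewrite big_cons.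
Qed.

Lemma linopE T v i : linop T -> T v i = \sum_j v j * T (unitv j) i.
Proof.
move=> lT; have {1}-> : v = fun l => \sum_j v j * unitv j l.
  apply/funext => l; rewrite (bigD1 l)//= /unitv eqxx mulr1 big1 ?addr0//.
  by move=> j jl; rewrite eq_sym (negbTE jl) mulr0.
by rewrite linop_sum.
Qed.

Lemma measurable_linop T : linop T -> measurable_fun setT T.
Proof.
move=> lT; apply: measurable_vecP => i.
rewrite (_ : (fun _ => _) = fun v => \sum_j v j * T (unitv j) i); last first.
  by apply/funext => v; exact: linopE.
apply: measurable_sum => j; apply: measurable_funM => //; exact: measurable_coord.
Qed.

Lemma measurable_scaleop k : measurable_fun setT (fun v :
  V => (fun l => k * v l) : V).
Proof.
apply: measurable_vecP => i; apply: measurable_funM => //;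
  exact: measurable_coord.
Qed.

Lemma linop_comp T1 T2 : linop T1 -> linop T2 -> linop (T1 \o T2).
Proof. by move=> l1 l2 a u v /=; rewrite l2 l1. Qed.

Lemma opbound_comp b1 b2 T1 T2 :
  opbound b1 T1 -> opbound b2 T2 -> opbound (b1 * b2) (T1 \o T2).
Proof. by move=> h1 h2 r v vr l /=; rewrite -mulrA; apply/h1/h2. Qed.

(** A linear [T1] commutes with the dilation produced by [T2], so dilation factors and constants
    multiply. *)
Lemma dom_comp K1 k1 T1 K2 k2 T2 : 0 <= K2 -> linop T1 -> linop T2 ->
  dom K1 k1 T1 -> dom K2 k2 T2 -> dom (K1 * K2) (k1 * k2) (T1 \o T2).
Proof.
move=> K20 l1 l2 d1 d2 g f gg mf f0 /=.
have mT1 := measurable_linop l1.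
apply: (le_trans (d2 g (f \o T1) gg (measurableT_comp mf mT1) (fun _ => f0 _))).
rewrite [K1 * K2]mulrC EFinM -muleA lee_wpmul2l ?lee_fin//=.
have E1 : (\int[g]_v f (T1 (fun l => k2 * v l)%R) =
    \int[g]_v f (fun l => k2 * T1 v l)%R)%E.
  by apply: eq_integral => v _; rewrite linopZ.
rewrite [leLHS]E1.
have := d1 g (fun v => f (fun l => k2 * v l)) gg
  (measurableT_comp mf (measurable_scaleop k2)) (fun _ => f0 _).
move=> h; apply: (le_trans h); rewrite le_eqVlt; apply/orP; left; apply/eqP.
congr (_ * _)%E; apply: eq_integral => v _; congr f; apply/funext => l.
by rewrite mulrA [k2 * _]mulrC.
Qed.

(** An elementary step dilates only the coordinates it touches. The others are widened too, at a
    bounded cost, since it is a common dilation that commutes with the linear maps composed with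
    it. *)
Lemma le_integral_scale_others (A : pred I) k (g : probability V R) (f :
  V -> \bar R) :
  1 <= k -> gaussian g -> measurable_fun setT f -> (forall v, 0 <= f v)%E ->
  (\int[g]_v f (fun l => if A l then k * v l else v l)%R <=
    (k ^+ #|I|)%:E * \int[g]_v f (fun l => k * v l)%R)%E.
Proof.
move=> k1 gg mf f0.
pose s l : R := if A l then 1 else k.
have s1 l : 1 <= s l by rewrite /s; case: ifP.
pose S (v : V) : V := fun l => if A l then k * v l else v l.
have mS : measurable_fun setT S.
  apply: measurable_vecP => l; rewrite /S; case: (A l);
    last exact: measurable_coord.
  by apply: measurable_funM => //; exact: measurable_coord.
have h := gaussian_upscale gg s1 (measurableT_comp mf mS) (fun _ => f0 _).
apply: (le_trans h).
have -> : (\int[g]_v (f \o S) (fun l => s l * v l)%R =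
    \int[g]_v f (fun l => k * v l)%R)%E.
  apply: eq_integral => v _ /=; congr f; apply/funext => l; rewrite /S /s.
  by case: (A l); rewrite ?mul1r.
apply: lee_wpmul2r; first exact: integral_ge0.
rewrite lee_fin -prodr_const; apply: ler_prod => l _.
by rewrite (le_trans ler01 (s1 l))/= /s; case: ifP.
Qed.

(** The premise admits [i = j] with [b = 0], the identity, because the pivot search below may return
    the row itself. *)
Lemma dom_shear (be b : R) (i j : I) : (i == j) ==> (b == 0) -> `|b| <= be ->
  dom ((2 + 2 * be) ^+ (2 + #|I|)) (2 + 2 * be) (fun v =>
    upd v i (v i + b * v j)).
Proof.
move=> ijb bbe g f gg mf f0; set k := 2 + 2 * be.
have be0 : 0 <= be by exact: le_trans bbe.
have k1 : 1 <= k by rewrite /k; lra.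
have k0 : 0 <= k by rewrite /k; lra.
have h A := le_integral_scale_others A k1 gg mf f0.
rewrite exprD EFinM -muleA.
have [ij|ij] := eqVneq i j.
  rewrite ij eqxx /= in ijb; rewrite (eqP ijb).
  apply: (@le_trans _ _ (\int[g]_v f (fun l =>
    if (fun=> false) l then k * v l else v l)%R)%E).
    rewrite le_eqVlt; apply/orP; left; apply/eqP.
    apply: eq_integral => v _; congr f; apply/funext => l.
    by rewrite /upd mul0r addr0; case: eqP => [->|].
  apply: (le_trans (h (fun=> false))); rewrite -[leLHS]mul1e lee_wpmul2r//.
    by rewrite mule_ge0 ?lee_fin ?exprn_ge0//; exact: integral_ge0.
  by rewrite lee_fin exprn_ege1.
apply: (le_trans (gaussian_shear gg ij bbe mf f0)); rewrite -/k.
rewrite lee_wpmul2l ?lee_fin ?sqr_ge0//.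
apply: le_trans (h (pred2 i j)).
rewrite le_eqVlt; apply/orP; left; apply/eqP.
apply: eq_integral => v _; congr f; apply/funext => l.
by rewrite /upd /=; case: eqP => [->|] //=; case: eqP => [->|].
Qed.

Lemma dom_scale (c de be : R) (i : I) : 0 < de <= `|c| -> `|c| <= be -> 1 <= be ->
  dom (be / de * be ^+ #|I|) be (fun v => upd v i (c * v i)).
Proof.
move=> /andP[de0 dec] cbe be1 g f gg mf f0.
have c0 : 0 < `|c| <= be by rewrite cbe (lt_le_trans de0).
have be0 : 0 <= be by exact: le_trans be1.
apply: (le_trans (gaussian_scale1 i gg c0 mf f0)).
have := le_integral_scale_others (pred1 i) be1 gg mf f0.
have -> : (\int[g]_v f (fun l => if pred1 i l then be * v l else v l)%R =
   \int[g]_v f (upd v i (be * v i)%R))%E.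
  apply: eq_integral => v _; congr f; apply/funext => l.
  by rewrite /upd /=; case: eqP => [->|].
move=> h; rewrite (EFinM (be / de)) -[leRHS]muleA; apply: lee_pmul => //.
- by rewrite lee_fin divr_ge0.
- exact: integral_ge0.
rewrite lee_fin ler_wpM2l// lef_pV2// posrE//; by case/andP: c0.
Qed.

Lemma linop_upd (F : V -> R) (i : I) :
  (forall (a : R) (u v : V), F (fun l => a * u l + v l) = a * F u + F v) ->
  linop (fun v => upd v i (F v)).
Proof.
by move=> lF a u v; apply/funext => l; rewrite /upd lF; case: (l == i).
Qed.

(** A row operation is a product of one scaling and of shears, peeled off along [s]; each factor
    costs a bounded constant. *)
Lemma dom_row (de be : R) (i : I) (d : R) (r : I -> R) (s : seq I) :
  0 < de <= `|d| -> `|d| <= be -> 1 <= be -> (forall j, `|r j| <= be) ->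
  i \notin s ->
  dom ((be / de * be ^+ #|I|) * ((2 + 2 * (be / de)) ^+ (2 + #|I|)) ^+ size s)
    (be * (2 + 2 * (be / de)) ^+ size s)
    (fun v => upd v i (d * v i + \sum_(j <- s) r j * v j)).
Proof.
move=> dde dbe be1 rbe; have /andP[de0 ded] := dde.
have be0 : 0 <= be by exact: le_trans be1.
elim: s => [_|j s IH].
  rewrite !expr0 !mulr1; have := dom_scale i dde dbe be1.
  by congr dom; apply/funext => v; rewrite big_nil addr0.
rewrite in_cons negb_or => /andP[ij /[dup] iNs /IH{}IH].
set K1 := _ ^+ (2 + _) in IH *; set k1 := 2 + _ in IH *.
rewrite [size _]/= (exprSr K1) (exprSr k1) (mulrA _ _ K1) (mulrA _ _ k1).
set M := (X in dom _ _ X) in IH.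
(* The shear acts before the scaling by [d], hence its slope [r j / d], bounded by [be / de]. *)
have -> : (fun v : V => upd v i (d * v i + \sum_(l <- j :: s) r l * v l)) =
    M \o (fun v => upd v i (v i + r j / d * v j)).
  apply/funext => v; apply/funext => l; rewrite /M /= /upd eqxx big_cons.
  case: (l == i) => //; rewrite mulrDr -addrA; congr (_ + (_ + _)).
    by rewrite mulrA [d * _]mulrC mulfVK// -normr_gt0 (lt_le_trans de0).
  by apply: eq_big_seq => m ms; case: eqP => // mi; rewrite -mi ms in iNs.
have k10 : 0 <= k1 by rewrite addr_ge0// mulr_ge0// divr_ge0// ltW.
apply: dom_comp => //.
- by rewrite /K1 exprn_ge0.
- apply: linop_upd => a u v; rewrite mulrDr mulrDr mulr_sumr addrACA.
  rewrite -big_split/= mulrCA; congr (_ + _ + _); apply: eq_bigr => m _.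
  by rewrite mulrDr mulrCA.
- apply: linop_upd => a u v; ring.
apply: dom_shear; first by rewrite (negbTE ij).
rewrite normrM normfV ler_pM// ?invr_ge0// lef_pV2// posrE//.
exact: lt_le_trans ded.
Qed.

(** * Gaussian elimination with pivots bounded below *)

Definition fixedrow T (i : I) := `[< forall v, T v i = v i >].

Lemma dom_row_all (de be : R) : 0 < de -> 1 <= be -> exists K k,
  [/\ 0 <= K, 1 <= k & forall (i : I) (F : V -> R),
    (forall (a : R) (u v : V), F (fun l => a * u l + v l) = a * F u + F v) ->
    (forall j, `|F (unitv j)| <= be) -> de <= `|F (unitv i)| ->
    dom K k (fun v => upd v i (F v))].
Proof.
move=> de0 be1.
have be0 : 0 <= be by exact: le_trans be1.
eexists; eexists; split; last first.
- move=> i F lF Fbe Fde.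
  have iNs : i \notin enum (predC1 i) by rewrite mem_enum !inE eqxx.
  have dde : 0 < de <= `|F (unitv i)| by rewrite de0.
  have := dom_row dde (Fbe i) be1 Fbe iNs.
  have -> : (fun v : V => upd v i (F (unitv i) * v i +
      \sum_(j <- enum (predC1 i)) F (unitv j) * v j)) = fun v => upd v i (F v).
    apply/funext => v; congr upd; rewrite big_enum/=.
    have := linopE v i (linop_upd i lF); rewrite {1}/upd eqxx => ->.
    rewrite [RHS](bigD1 i)//= mulrC; congr (_ + _).
      by rewrite /upd eqxx mulrC.
    by apply: eq_bigr => j _; rewrite /upd eqxx mulrC.
  rewrite -cardE cardC1; exact.
- rewrite -[leLHS]mulr1 ler_pM// exprn_ege1// -[leLHS]addr0 lerD ?ler1n//.
  by rewrite mulr_ge0// divr_ge0// ltW.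
apply: mulr_ge0; first by rewrite mulr_ge0 ?divr_ge0 ?exprn_ge0// ltW.
by do 2 apply: exprn_ge0; rewrite addr_ge0// mulr_ge0// divr_ge0// ltW.
Qed.


(** Split [T] as [M] followed by [T \o M'], where [M] replaces only coordinate [i] by that of [T v]
    and [M'] is its inverse, bounded because the pivot is bounded below. The row operation [M] is
    dominated directly, and [T \o M'] fixes row [i] besides all the rows fixed by [T], so the
    premise applies to it. There [be] is universally quantified because the bound grows at each
    step. *)
Lemma dom_pivot (n : nat) :
  (forall be : R, 1 <= be -> exists K k,
     [/\ 0 <= K, 1 <= k & forall T T', linop T -> linop T' ->
     opbound be T -> opbound be T' -> (forall v, T (T' v) = v) ->
     (#|[pred i | ~~ fixedrow T i]| <= n)%N -> dom K k T]) ->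
  forall be de : R, 1 <= be -> 0 < de -> exists K k,
     [/\ 0 <= K, 1 <= k & forall T T' i, linop T -> linop T' ->
     opbound be T -> opbound be T' -> (forall v, T (T' v) = v) ->
     (#|[pred i | ~~ fixedrow T i]| <= n.+1)%N ->
     ~~ fixedrow T i -> de <= `|T (unitv i) i| -> dom K k T].
Proof.
move=> IH be de be1 de0.
have be0 : 0 <= be by exact: le_trans be1.
(* [b2] bounds [M']; [b3] bounds both [T \o M'], by [be * b2], and its inverse [M \o T'], by
   [be * be]. *)
pose b2 := 1 + (1 + be) / de; pose b3 := be * b2 + be * be.
have b20 : 0 <= b2 by rewrite addr_ge0// divr_ge0 ?addr_ge0// ltW.
have b31 : 1 <= b3.
  by rewrite -[leLHS]mulr1 -[leLHS]add0r lerD ?mulr_ge0// ler_pM.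
have [K1 [k1 [K10 k11 h1]]] := IH b3 b31.
have [K2 [k2 [K20 k21 h2]]] := dom_row_all de0 be1.
exists (K1 * K2), (k1 * k2); split; [exact: mulr_ge0| |].
  by rewrite -[leLHS]mulr1 ler_pM.
move=> T T' i lT lT' bT bT' TT' bad iT dT.
set d := T (unitv i) i in dT.
have d0 : d != 0 by rewrite -normr_gt0 (lt_le_trans de0).
pose M (v : V) : V := upd v i (T v i).
pose M' (v : V) : V := upd v i (v i + (v i - T v i) / d).
have TM' v : T (M' v) = fun l => (v i - T v i) / d * T (unitv i) l + T v l.
  rewrite -lT; congr T; apply/funext => l; rewrite /M' /upd /unitv.
  by case: eqP => [->|]; rewrite ?mulr1 ?mulr0 ?add0r// addrC.
have TF (a : R) (u v : V) : T (fun l => a * u l + v l) i = a * T u i + T v i.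
  by rewrite lT.
have lM : linop M by exact: linop_upd.
have lM' : linop M'.
  by apply: (@linop_upd (fun v => v i + (v i - T v i) / d)) => a u v;
    rewrite lT; ring.
have MK v : M' (M v) = v.
  have TMi : T (M v) i = T v i + (T v i - v i) * d.
    rewrite (_ : M v = fun l => (T v i - v i) * unitv i l + v l).
      by rewrite lT addrC.
    apply/funext => l; rewrite /M /upd /unitv.
    by case: eqP => [->|]; rewrite ?mulr1 ?mulr0 ?add0r ?subrK.
  apply/funext => l; rewrite /M' /upd TMi.
  case: eqP => [->|/eqP li]; last by rewrite /M /upd (negbTE li).
  by rewrite /M /upd eqxx opprD addrA subrr sub0r -mulNr mulfK// opprB addrC subrK.
have KM v : M (M' v) = v.
  apply/funext => l; rewrite {1}/M /upd TM' -/d.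
  case: eqP => [->|/eqP li]; last by rewrite /M' /upd (negbTE li).
  by rewrite mulfVK// subrK.
have -> : T = (T \o M') \o M by apply/funext => v /=; rewrite MK.
have u1 (j l : I) : `|unitv j l| <= 1.
  by rewrite /unitv; case: (l == j); rewrite ?normr1 ?normr0.
have bM : opbound be M.
  move=> r v vr l; rewrite /M /upd; case: eqP => _; first exact: bT.
  by rewrite (le_trans (vr l))// ler_peMl// (le_trans _ (vr i)).
have bM' : opbound b2 M'.
  move=> r v vr l; have r0 : 0 <= r by rewrite (le_trans _ (vr i)).
  have h0 : 0 <= (1 + be) / de * r by rewrite mulr_ge0// divr_ge0 ?addr_ge0// ltW.
  rewrite /M' /upd /b2 [leRHS]mulrDl mul1r; case: eqP => _; last first.
    by rewrite (le_trans (vr l))// lerDl.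
  rewrite (le_trans (ler_normD _ _))// lerD//.
  rewrite normrM mulrAC ler_pM//;
    last by rewrite normfV lef_pV2// posrE normr_gt0.
  by rewrite (le_trans (ler_normB _ _))// mulrDl mul1r lerD// bT.
apply: dom_comp => //; first exact: linop_comp; last first.
  apply: (h2 i (fun v => T v i) TF _ dT) => j.
  by rewrite -[leRHS]mulr1; apply: bT.
apply: (h1 _ (M \o T')).
- exact: linop_comp.
- exact: linop_comp.
- move=> r v vr l; have r0 : 0 <= r by rewrite (le_trans _ (vr i)).
  rewrite (le_trans (opbound_comp bT bM' vr l))// ler_wpM2r// /b3 lerDl.
  exact: mulr_ge0.
- move=> r v vr l; have r0 : 0 <= r by rewrite (le_trans _ (vr i)).
  rewrite (le_trans (opbound_comp bM bT' vr l))// ler_wpM2r// /b3 lerDr.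
  exact: mulr_ge0.
- by move=> v /=; rewrite MK TT'.
rewrite -ltnS; apply: leq_trans bad; apply: proper_card; apply/properP; split.
  apply/fintype.subsetP => j; rewrite !inE; apply: contra => /asboolP Tj.
  apply/asboolP => v /=; rewrite Tj /M' /upd; case: eqP => // ji.
  by rewrite -ji Tj subrr mul0r addr0.
exists i; first by rewrite inE.
rewrite inE negbK; apply/asboolP => v /=; rewrite TM' -/d.
by rewrite mulfVK// subrK.
Qed.


Lemma dom_id (K k : R) : 1 <= k -> k ^+ #|I| <= K -> dom K k idfun.
Proof.
move=> k1 kK g f gg mf f0.
have := le_integral_scale_others (fun=> false) k1 gg mf f0.
move=> h; apply: (le_trans h); apply: lee_wpmul2r; first exact: integral_ge0.
by rewrite lee_fin.
Qed.

Lemma domW (K K' k : R) T : K <= K' -> dom K k T -> dom K' k T.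
Proof.
move=> KK d g f gg mf f0; apply: (le_trans (d g f gg mf f0)).
by apply: lee_wpmul2r; [exact: integral_ge0|rewrite lee_fin].
Qed.

(** Let [w] be the image of the [i]-th unit vector under [T']. Its entries are at most [be] and
    vanish at the fixed rows, while coordinate [i] of [T w] is [1]; so an entry of row [i] in an
    unfixed column reaches the average share. *)
Lemma exists_pivot (be : R) T T' i : 1 <= be -> linop T -> opbound be T' ->
  (forall v, T (T' v) = v) -> ~~ fixedrow T i ->
  exists2 j, ~~ fixedrow T j & (#|I|%:R * be)^-1 <= `|T (unitv j) i|.
Proof.
move=> be1 lT bT' TT' bad; apply/not_exists2P => H.
have be0 : 0 < be by exact: lt_le_trans be1.
have I0 : 0 < #|I|%:R :> R by rewrite ltr0n; apply/card_gt0P; exists i.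
pose w := T' (unitv i).
have wle j : `|w j| <= be.
  rewrite -[leRHS]mulr1; apply: bT' => l; rewrite /unitv.
  by case: (l == i); rewrite ?normr1 ?normr0.
have : `|T w i| < 1.
  rewrite linopE//; apply: (le_lt_trans (ler_norm_sum _ _ _)).
  apply: (@lt_le_trans _ _ (\sum_(j : I) #|I|%:R^-1)); last first.
    by rewrite sumr_const -[_ *+ _]mulr_natl divff// gt_eqF.
  apply: ltr_sum; first by apply/hasP; exists i => //; rewrite mem_index_enum.
  move=> j _; rewrite normrM.
  have [jf|jb] := boolP (fixedrow T j).
    have -> : w j = 0.
      have /asboolP <- := jf; rewrite TT' /unitv.
      by case: eqP => // ji; rewrite -ji jf in bad.
    by rewrite normr0 mul0r invr_gt0.
  have [//|/negP] := H j; rewrite -ltNge invfM ltr_pdivlMr// mulrC => h.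
  by apply: le_lt_trans h; rewrite ler_wpM2r.
by rewrite TT' /unitv eqxx normr1 ltxx.
Qed.

(** The large entry of row [i] may lie off the diagonal, in column [j]. Adding coordinate [i] to
    coordinate [j] beforehand adds that entry to the diagonal one and makes it a usable pivot; row
    [j] is unfixed, so no fixed row is spoilt. *)
Lemma dom_inv_rec (n : nat) (be : R) : 1 <= be -> exists K k,
  [/\ 0 <= K, 1 <= k & forall T T', linop T -> linop T' ->
   opbound be T -> opbound be T' -> (forall v, T (T' v) = v) ->
   (#|[pred i | ~~ fixedrow T i]| <= n)%N -> dom K k T].
Proof.
have Tid T : [pred i | ~~ fixedrow T i] =i pred0 -> T = idfun.
  move=> h; apply/funext => v; apply/funext => i.
  by have := h i; rewrite !inE => /negbFE/asboolP.
elim: n be => [|n IH] be be1.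
  exists 1, 1; split => // T T' _ _ _ _ _; rewrite leqn0 => /eqP/card0_eq/Tid ->.
  by apply: dom_id; rewrite ?expr1n.
have be0 : 0 < be by exact: lt_le_trans be1.
(* At most half of the entry given by [exists_pivot]: if the diagonal entry is below [de], adding an
   entry of at least [2 * de] leaves at least [de]. The successor keeps [de] positive for an empty
   index type. *)
pose de := (#|I|.+1%:R * be)^-1 / 2.
have de0 : 0 < de by rewrite divr_gt0// invr_gt0 mulr_gt0.
have b21 : 1 <= be * 2 by rewrite -[leLHS]mulr1 ler_pM// ler1n.
have [K1 [k1 [K10 k11 h1]]] := dom_pivot IH b21 de0.
pose K2 : R := (2 + 2 * 1) ^+ (2 + #|I|); pose k2 : R := 2 + 2 * 1.
have k21 : 1 <= k2 by rewrite /k2; lra.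
have k12 : 1 <= k1 * k2 by rewrite -[leLHS]mulr1 ler_pM.
have K20 : 0 <= K2 by rewrite /K2 -/k2 exprn_ge0// (le_trans ler01).
(* The second summand serves the identity, the case where every row is fixed. *)
exists (K1 * K2 + (k1 * k2) ^+ #|I|), (k1 * k2); split => //.
  apply: addr_ge0; first exact: mulr_ge0.
  by apply: exprn_ge0; exact: le_trans k12.
move=> T T' lT lT' bT bT' TT' nbad.
have [i iT|/Tid ->] := pickP [pred i | ~~ fixedrow T i]; last first.
  by apply: dom_id => //; rewrite lerDr mulr_ge0.
rewrite inE in iT; have [j jT dj] := exists_pivot be1 lT bT' TT' iT.
apply: (@domW (K1 * K2)); first by rewrite lerDl exprn_ge0// (le_trans ler01).
have dej : 2 * de <= `|T (unitv j) i|.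
  apply: le_trans dj; rewrite /de mulrC mulfVK//.
  rewrite lef_pV2 ?posrE ?mulr_gt0 ?ltr0n//; last by apply/card_gt0P; exists i.
  by rewrite ler_wpM2r ?ler_nat// ltW.
pose al : R := if `|T (unitv i) i| < de then 1 else 0.
have al0 : (j == i) ==> (al == 0).
  apply/implyP => /eqP ji; rewrite ji in dej; rewrite /al ltNge.
  by rewrite (le_trans _ dej)//= mulr_natl mulr2n lerDl ltW.
have al1 : 0 <= al <= 1 by rewrite /al; case: ifP; rewrite !lexx ler01.
have nal (c : R) : (c == al) || (c == - al) -> (j == i) ==> (c == 0) /\ `|c| <= 1.
  move=> c_al; have -> : `|c| = al.
    have /andP[ge0 _] := al1.
    by case/orP: c_al => /eqP ->; rewrite ?normrN ger0_norm.
  have /andP[_ ->] := al1; split=> //; apply/implyP => /(implyP al0)/eqP z.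
  by case/orP: c_al => /eqP ->; rewrite z ?oppr0.
pose U (c : R) (v : V) : V := upd v j (v j + c * v i).
have lU c : linop (U c) by apply: linop_upd => a u v; ring.
have UK (c : R) v : (c == al) || (c == - al) -> U c (U (- c) v) = v.
  move=> /nal[cji _]; apply/funext => l; rewrite {1}/U /upd.
  case: eqP => [->|/eqP lj]; last by rewrite /U /upd (negbTE lj).
  rewrite /U /upd eqxx eq_sym; case: eqP cji => [ji /eqP ->|_ _].
    by rewrite oppr0 !mul0r !addr0.
  by rewrite mulNr subrK.
have bU (c : R) : `|c| <= 1 -> opbound 2 (U c).
  move=> c1 r v vr l; have r0 : 0 <= r by rewrite (le_trans _ (vr i)).
  rewrite /U /upd mulr_natl mulr2n; case: eqP => _; last first.
    by rewrite (le_trans (vr l))// lerDl.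
  rewrite (le_trans (ler_normD _ _))// lerD// normrM -[leRHS]mul1r.
  by rewrite ler_pM.
have [Nal0 Nal1] := nal (- al) (introT orP (or_intror (eqxx _))).
have [_ al1'] := nal al (introT orP (or_introl (eqxx _))).
have -> : T = (T \o U al) \o U (- al).
  by apply/funext => v /=; rewrite UK ?eqxx.
apply: dom_comp => //; [exact: linop_comp| |exact: dom_shear].
have bb (c : R) S1 S2 : `|c| <= 1 -> opbound be S1 -> opbound be S2 ->
    opbound (be * 2) (S1 \o U c) /\ opbound (be * 2) (U c \o S2).
  move=> c1 b1 b2; split; first exact: opbound_comp b1 (bU _ c1).
  by rewrite mulrC; exact: opbound_comp (bU _ c1) b2.
apply: (h1 _ (U (- al) \o T') i) => //.
- exact: linop_comp.
- exact: linop_comp.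
- by have [] := bb al T T' al1' bT bT'.
- by have [] := bb (- al) T T' Nal1 bT bT'.
- by move=> v /=; rewrite UK ?eqxx.
- apply: leq_trans nbad; apply: subset_leq_card.
  apply/fintype.subsetP => l; rewrite !inE; apply: contra => /asboolP Tl.
  apply/asboolP => v /=; rewrite Tl /U /upd; case: eqP => // lj.
  by rewrite lj in Tl; case/negP: jT; apply/asboolP.
- apply: contra iT => /asboolP TUi; apply/asboolP => v.
  have := TUi (U (- al) v); rewrite /= UK ?eqxx// => ->.
  rewrite /U /upd; case: eqP => // ij; have /implyP := Nal0.
  by rewrite ij eqxx => /(_ isT)/eqP ->; rewrite mul0r addr0.
rewrite /= (_ : U al (unitv i) = fun l => al * unitv j l + unitv i l).
  rewrite lT /al; case: ifPn => [h|]; last by rewrite mul0r add0r -leNgt.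
  rewrite mul1r; apply: le_trans (lerB_normD _ _); rewrite lerBrDr.
  by apply: le_trans dej; rewrite mulr_natl mulr2n lerD2l ltW.
apply/funext => l; rewrite /U /upd /unitv eqxx mulr1.
by case: eqP => [->|_]; rewrite ?mulr1 ?mulr0 ?add0r// addrC.
Qed.

Lemma dom_inv (be : R) : exists K k,
  [/\ 0 <= K, 1 <= k & forall T T', linop T -> linop T' ->
   opbound be T -> opbound be T' -> (forall v, T (T' v) = v) -> dom K k T].
Proof.
have m1 : 1 <= Num.max 1 be by rewrite le_max lexx.
have [K [k [K0 k1 h]]] := dom_inv_rec #|I| m1.
exists K, k; split => // T T' lT lT' bT bT' TT'; apply: (h T T') => //.
- move=> r v vr l; apply: (le_trans (bT r v vr l)).
  by rewrite ler_wpM2r ?le_max ?lexx ?orbT// (le_trans _ (vr l)).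
- move=> r v vr l; apply: (le_trans (bT' r v vr l)).
  by rewrite ler_wpM2r ?le_max ?lexx ?orbT// (le_trans _ (vr l)).
- exact: max_card.
Qed.

End domination.

(** * Complex numbers *)

Section complex_modulus.
Context {R : realType}.
Implicit Types z w : R[i].

Definition cpart (b : bool) z : R := if b then complex.Re z else complex.Im z.

Lemma normc_ge0 z : 0 <= normc z.
Proof. by case: z => a b; exact: sqrtr_ge0. Qed.

Lemma sqr_normc z : normc z ^+ 2 = complex.Re z ^+ 2 + complex.Im z ^+ 2.
Proof. by case: z => a b /=; rewrite sqr_sqrtr// addr_ge0// sqr_ge0. Qed.

Lemma cpart_le b z : `|cpart b z| <= normc z.
Proof.
rewrite -(@ler_pXn2r _ 2)// ?nnegrE ?normc_ge0// sqr_normc real_normK ?num_real//.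
by rewrite /cpart; case: b; rewrite ?lerDl ?lerDr sqr_ge0.
Qed.

Lemma normc_le z (r : R) : (forall b, `|cpart b z| <= r) -> normc z <= 2 * r.
Proof.
move=> zr; have r0 : 0 <= r by exact: le_trans (zr true).
rewrite -(@ler_pXn2r _ 2)// ?nnegrE ?normc_ge0 ?mulr_ge0//.
have h b : cpart b z ^+ 2 <= r ^+ 2.
  by rewrite -(real_normK (num_real _)) ler_pXn2r// nnegrE.
rewrite sqr_normc exprMn; have /= := h true; have /= := h false.
by have := sqr_ge0 r; lra.
Qed.

Lemma normc_sum (J : Type) (r : seq J) (F : J -> R[i]) :
  normc (\sum_(j <- r) F j) <= \sum_(j <- r) normc (F j).
Proof.
elim: r => [|j r IH]; first by rewrite !big_nil normc0.
by rewrite !big_cons (le_trans (le_normcD _ _))// lerD2l.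
Qed.

Lemma cpartD b z w : cpart b (z + w) = cpart b z + cpart b w.
Proof. by case: b; case: z => ? ?; case: w => ? ?. Qed.

Lemma cpartZ b (a : R) z : cpart b (a%:C%C * z) = a * cpart b z.
Proof. by case: b; case: z => x y /=; rewrite mul0r ?subr0 ?addr0. Qed.

(** Numbers of modulus at most [1] are rounded to [1], with error at most [2]. Larger ones are
    represented exactly, with the least [k] such that [2 ^+ k] is at least the modulus, which puts
    the modulus of [c] in [[1/2, 1]]. *)
Lemma exists_dyadic z : exists (k : nat) (c : R[i]),
  [/\ 2^-1 <= normc c <= 1, normc (z - c * (2 ^+ k)%:C%C) <= 2,
      2 ^+ k <= 2 * (1 + normc z) & normc z <= 2 ^+ k].
Proof.
have z0 := normc_ge0 z.
have [z1|z1] := leP (normc z) 1.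
  exists 0%N, 1; rewrite normc1 lexx invf_le1// ler1n expr0 mulr1; split => //.
    apply: (le_trans (le_normcD _ _)); rewrite normcN normc1; lra.
  lra.
have ex : exists k, normc z <= 2 ^+ k.
  exists (Num.bound (normc z)); apply: ltW.
  apply: (lt_le_trans (archi_boundP z0)).
  by rewrite -natrX ler_nat ltnW// ltn_expl.
have [k zk kmin] := ex_minnP ex.
case: k zk kmin => [|k] zk kmin; first by rewrite expr0 leNgt z1 in zk.
have zk' : 2 ^+ k < normc z.
  by rewrite ltNge; apply/negP => /kmin; rewrite ltnn.
have nk (j : nat) : normc ((2 ^+ j)%:C%C : R[i]) = 2 ^+ j.
  by rewrite /= expr0n/= addr0 sqrtr_sqr ger0_norm// exprn_ge0.
have k0 (j : nat) : 0 < 2 ^+ j :> R by rewrite exprn_gt0.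
have kn0 : (2 ^+ k.+1)%:C%C != 0 :> R[i].
  by apply/eqP => /complexI/eqP; rewrite gt_eqF.
exists k.+1, (z / (2 ^+ k.+1)%:C%C); split => //.
- rewrite normcM normcV nk ler_pdivrMr// mul1r zk andbT ler_pdivlMr//.
  by rewrite exprS mulrA mulVf// mul1r ltW.
- by rewrite mulfVK// subrr normc0.
- by rewrite exprS ler_pM2l// (le_trans (ltW zk'))// lerDr.
Qed.

(** Gaussian integers in a square about the origin, a constant times [4 ^ k] of them. The half-side
    [13 * 2 ^ k] generously exceeds the range [2 * 2 ^ k] to be covered and affects only
    constants. *)
Definition gridpt (k : nat) (t : 'I_(26 * 2 ^ k) * 'I_(26 * 2 ^ k)) : R[i] :=
  Complex (t.1%:R - (13 * 2 ^ k)%:R) (t.2%:R - (13 * 2 ^ k)%:R).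

Lemma exists_gridpt (k : nat) z : normc z <= 2 * 2 ^+ k ->
  exists t, normc (z - gridpt (k := k) t) <= 2.
Proof.
move=> zk.
have K1 : 1 <= 2 ^+ k :> R by rewrite exprn_ege1// ler1n.
have round b : exists t : 'I_(26 * 2 ^ k),
    `|cpart b z - (t%:R - (13 * 2 ^ k)%:R)| <= 1.
  have := le_trans (cpart_le b z) zk; rewrite ler_norml => /andP[lo hi].
  set x := cpart b z in lo hi *.
  have x0 : 0 <= x + (13 * 2 ^ k)%:R by rewrite natrM natrX; lra.
  have /andP[t1 t2] := Num.Theory.truncn_itv x0.
  set t := Num.truncn _ in t1 t2.
  have tlt : (t < 26 * 2 ^ k)%N.
    by rewrite -(ltr_nat R) (le_lt_trans t1)// !natrM !natrX; lra.
  exists (Ordinal tlt) => /=; rewrite -natr1 in t2.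
  rewrite ler_norml; apply/andP; split; lra.
have [[t1 h1] [t2 h2]] := (round true, round false).
exists (t1, t2); rewrite -[leRHS]mulr1; apply: normc_le => -[] //.
  by move: h1; rewrite /gridpt; case: z {round zk h2}.
by move: h2; rewrite /gridpt; case: z {round zk h1}.
Qed.

End complex_modulus.

(** * The channel as a linear map of the noise *)

Section channel.
Context {R : realType} {N M Q : nat}.
Local Notation C := R[i].
Local Notation I := ((('I_M * 'I_Q) * bool) + (('I_M * 'I_N) * bool))%type.
Local Notation O := (('I_M * 'I_N) * bool)%type.
Local Notation V := (vec R I).

Definition Smx (v : V) : 'M[C]_(M, Q) :=
  \matrix_(m, q) Complex (v (inl (m, q, true))) (v (inl (m, q, false))).

Definition Wmx (v : V) : 'M[C]_(M, N) :=
  \matrix_(m, n) Complex (v (inr (m, n, true))) (v (inr (m, n, false))).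

Definition pack (S : 'M[C]_(M, Q)) (W : 'M[C]_(M, N)) : V := fun k =>
  match k with
  | inl (m, q, b) => cpart b (S m q)
  | inr (m, n, b) => cpart b (W m n)
  end.

Lemma Smx_pack S W : Smx (pack S W) = S.
Proof. by apply/matrixP => m q; rewrite mxE /=; case: (S m q). Qed.

Lemma Wmx_pack S W : Wmx (pack S W) = W.
Proof. by apply/matrixP => m q; rewrite mxE /=; case: (W m q). Qed.

Lemma packK v : pack (Smx v) (Wmx v) = v.
Proof. by apply/funext => -[[[m q] []]|[[m n] []]]; rewrite /= mxE. Qed.

Lemma SmxD (a : R) (u v : V) :
  Smx (fun l => a * u l + v l) = a%:C%C *: Smx u + Smx v.
Proof. by apply/matrixP => m q; rewrite !mxE; apply/eqP;
  rewrite eq_complex /= !mul0r subr0 addr0 !eqxx. Qed.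

Lemma WmxD (a : R) (u v : V) :
  Wmx (fun l => a * u l + v l) = a%:C%C *: Wmx u + Wmx v.
Proof. by apply/matrixP => m q; rewrite !mxE; apply/eqP;
  rewrite eq_complex /= !mul0r subr0 addr0 !eqxx. Qed.

Lemma packD (a : R) S1 S2 W1 W2 :
  pack (a%:C%C *: S1 + S2) (a%:C%C *: W1 + W2) =
  fun l => a * pack S1 W1 l + pack S2 W2 l.
Proof.
by apply/funext => -[[[m q] b]|[[m n] b]]; rewrite /= !mxE cpartD cpartZ.
Qed.

(** These are the substitutions in the noise that turn one channel matrix into another: [A] acts on
    the fading, and [B] feeds a multiple of the fading into the additive noise. *)
Definition lop (A : 'M[C]_Q) (B : 'M[C]_(Q, N)) (v : V) : V :=
  pack (Smx v *m A) (Wmx v + Smx v *m B).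

Lemma linop_lop A B : linop (lop A B).
Proof.
move=> a u v; rewrite /lop SmxD WmxD !mulmxDl -!scalemxAl addrACA -scalerDr.
exact: packD.
Qed.

(** [lop] is block triangular with an identity block, so its inverse has the same form and obeys a
    bound of the same kind. *)
Lemma lopK A A' B v : A' *m A = 1%:M ->
  lop A B (lop A' (- (A' *m B)) v) = v.
Proof.
move=> AA; rewrite /lop Smx_pack Wmx_pack -mulmxA AA mulmx1 mulmxN mulmxA.
by rewrite subrK packK.
Qed.

Lemma normc_Smx (r : R) v : (forall l, `|v l| <= r) ->
  forall m q, normc (Smx v m q) <= 2 * r.
Proof. by move=> vr m q; rewrite mxE; apply: normc_le => -[]; exact: vr. Qed.

Lemma normc_mulmx p n1 n2 (a b : R) (A : 'M[C]_(n1, p)) (B : 'M[C]_(p, n2)) :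
  (forall i j, normc (A i j) <= a) -> (forall i j, normc (B i j) <= b) ->
  forall i j, normc ((A *m B) i j) <= p%:R * (a * b).
Proof.
move=> Aa Bb i j; rewrite mxE (le_trans (normc_sum _ _))//.
rewrite -[X in X%:R]card_ord mulr_natl -sumr_const ler_sum// => l _.
by rewrite normcM ler_pM ?normc_ge0.
Qed.

Lemma opbound_lop (al : R) (A : 'M[C]_Q) (B : 'M[C]_(Q, N)) : 0 <= al ->
  (forall i j, normc (A i j) <= al) -> (forall i j, normc (B i j) <= al) ->
  opbound (1 + Q%:R * (2 * al)) (lop A B).
Proof.
move=> al0 Aal Bal r v vr l; have r0 : 0 <= r by exact: le_trans (vr l).
have Sr := normc_Smx vr.
have E : Q%:R * (2 * r * al) = Q%:R * (2 * al) * r by ring.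
case: l => [[[m q] b]|[[m n] b]] /=.
  apply: (le_trans (cpart_le _ _)); apply: (le_trans (normc_mulmx Sr Aal _ _)).
  by rewrite E [leRHS]mulrDl mul1r lerDr.
rewrite mxE cpartD (le_trans (ler_normD _ _))// mulrDl mul1r lerD//.
  by rewrite mxE /cpart; case: b; exact: vr.
by apply: (le_trans (cpart_le _ _)); rewrite -E; exact: (normc_mulmx Sr Bal).
Qed.

Lemma dom_lop (al : R) : exists K k, [/\ 0 <= K, 1 <= k &
  forall (A A' : 'M[C]_Q) (B : 'M[C]_(Q, N)), A' *m A = 1%:M ->
   (forall i j, normc (A i j) <= al) -> (forall i j, normc (A' i j) <= al) ->
   (forall i j, normc (B i j) <= al) -> dom K k (lop A B)].
Proof.
(* [al'] makes the bound nonnegative; [a2] also bounds the entries of [A' *m B], which occur in the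
   inverse. *)
pose al' := Num.max 0 al; pose a2 := al' + Q%:R * (al' * al').
have al0 : 0 <= al' by rewrite le_max lexx.
have q0 : 0 <= Q%:R * (al' * al') by rewrite !mulr_ge0.
have [K [k [K0 k1 h]]] := @dom_inv R I (1 + Q%:R * (2 * a2)).
exists K, k; split => // A A' B AA Aal A'al Bal.
have alal : al <= al' by rewrite le_max lexx orbT.
apply: (h _ (lop A' (- (A' *m B)))).
- exact: linop_lop.
- exact: linop_lop.
- apply: opbound_lop; first exact: addr_ge0.
    by move=> i j; rewrite (le_trans (Aal i j))// (le_trans alal)// lerDl.
  by move=> i j; rewrite (le_trans (Bal i j))// (le_trans alal)// lerDl.
- apply: opbound_lop; first exact: addr_ge0.
    by move=> i j; rewrite (le_trans (A'al i j))// (le_trans alal)// lerDl.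
  move=> i j; rewrite mxE normcN; apply: (@le_trans _ _ (Q%:R * (al' * al'))).
    apply: normc_mulmx => ? ?; apply: le_trans alal; [exact: A'al|exact: Bal].
  by rewrite lerDr.
- by move=> v; exact: lopK.
Qed.

Definition outv (Y : 'M[C]_(M, N)) : vec R O :=
  fun k => cpart k.2 (Y k.1.1 k.1.2).

(** [D] lets the noise have a different size in each column, as the bound by [M (1 - Q/N)] requires;
    the true channel has [D = 1]. *)
Definition lout (F : 'M[C]_(Q, N)) (D : 'M[C]_N) (v : V) : vec R O :=
  outv (Smx v *m F + Wmx v *m D).

Definition chan (Pm : 'M[C]_(N, Q)) (x : 'rV[C]_N) : V -> vec R O :=
  lout (Pm^T *m diag_mx x) 1%:M.

Lemma measurable_lout F D : measurable_fun setT (lout F D).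
Proof.
pose h (v : V) : V := pack 0 (Smx v *m F + Wmx v *m D).
have lh : linop h.
  move=> a u v; rewrite /h SmxD WmxD !mulmxDl -!scalemxAl addrACA -scalerDr.
  by rewrite -packD scaler0 addr0.
apply: measurable_vecP => -[[m n] b].
exact: (measurableT_comp (@measurable_coord R I (inr (m, n, b))) (measurable_linop lh)).
Qed.

Lemma lout_lop F D A B v :
  lout F D (lop A B v) = lout (A *m F + B *m D) D v.
Proof.
by rewrite /lout Smx_pack Wmx_pack mulmxDl mulmxDr !mulmxA [_ + _ *m B *m D]addrC addrA.
Qed.

Lemma dom_preimage (K k : R) (T : V -> V) F D (g : probability V R)
    (B : set (vec R O)) :
  dom K k T -> linop T -> gaussian g -> measurable B ->
  (g ((lout F D \o T) @^-1` B) <=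
   K%:E * g ((fun v => lout F D (fun l => k * v l)%R) @^-1` B))%E.
Proof.
move=> dT lT gg mB.
have mL := measurable_lout F D.
have h := dT g (fun v => (\1_B (lout F D v))%:E) gg.
have mf : measurable_fun setT (fun v => (\1_B (lout F D v) : R)%:E).
  apply/measurable_EFinP; apply: (measurableT_comp _ mL).
  exact: measurable_indic.
have {}h := h mf (fun v => _).
have E (X : V -> V) : measurable_fun setT X ->
    (\int[g]_v (\1_B (lout F D (X v)))%:E = g ((lout F D \o X) @^-1` B))%E.
  move=> mX; have mB' : measurable ((lout F D \o X) @^-1` B).
    by rewrite -[X in measurable X]setTI; exact: (measurableT_comp mL mX).
  transitivity (\int[g]_v (\1_((lout F D \o X) @^-1` B) v)%:E)%E => //.
  by rewrite integral_indic// setIT.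
rewrite -E; last exact: measurable_linop.
rewrite -(E (fun v l => k * v l)); last exact: measurable_scaleop.
by apply: h => v; rewrite lee_fin.
Qed.

Definition energy (x : 'rV[C]_N) : R := \sum_n normc (x 0 n) ^+ 2.

(* The net has countably many levels [Ix k]; an input of energy [E] is served
   by a level [k <= ln E + O(1)], and [#|Ix k| * K], the cost of that level, is
   [E ^ a] up to factors polynomial in [k]. *)
Definition covered (Pm : 'M[C]_(N, Q)) (a : nat) := exists (Ix : nat -> finType)
    (L : forall k, Ix k -> V -> vec R O) (c : R) (b : nat),
  [/\ 0 < c, forall k i, measurable_fun setT (L k i) &
   forall x : 'rV[C]_N, exists k (i : Ix k) (K : R),
   [/\ 0 <= K, expR k%:R <= c * (1 + energy x),
      #|Ix k|%:R * K <= c * k.+1%:R ^+ b * (1 + energy x) ^+ a &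
      forall (g : probability V R) (B :
        set (vec R O)), gaussian g -> measurable B ->
      (g (chan Pm x @^-1` B) <= K%:E * g (L k i @^-1` B))%E]].

Lemma energy_ge0 (x : 'rV[C]_N) : 0 <= energy x.
Proof. by apply: sumr_ge0 => n _; exact: sqr_ge0. Qed.

Lemma le_energy (x : 'rV[C]_N) n : normc (x 0 n) ^+ 2 <= energy x.
Proof.
by rewrite /energy (bigD1 n)//= lerDl sumr_ge0// => j _; exact: sqr_ge0.
Qed.

Lemma expR_le4 (k : nat) : expR k%:R <= 4 ^+ k :> R.
Proof.
have h : expR 1 <= 4 :> R.
  have e2 : expR (2^-1) <= 2 :> R.
    have := expR_ge1Dx (- 2^-1 : R); rewrite expRN => h.
    rewrite -[leRHS]invrK -[leLHS]invrK lef_pV2 ?posrE ?invr_gt0 ?expR_gt0//.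
    by apply: le_trans h; lra.
  have -> : 1 = 2^-1 + 2^-1 :> R by lra.
  rewrite expRD; have e0 := expR_gt0 (2^-1 : R); nra.
by rewrite -[k%:R]mulr1 expRM_natl lerXn2r// nnegrE ?expR_ge0.
Qed.

(** With [t] the modulus, [2 ^ k <= 2 (1 + t)] gives [4 ^ k <= 4 (1 + t) ^ 2 <= 8 (1 + t ^ 2)]. *)
Lemma four_pow (k : nat) (x : 'rV[C]_N) n :
  2 ^+ k <= 2 * (1 + normc (x 0 n)) -> 4 ^+ k <= 8 * (1 + energy x).
Proof.
move=> h; have z0 := normc_ge0 (x 0 n); have e := le_energy x n.
have -> : 4 ^+ k = (2 ^+ k) ^+ 2 :> R.
  by rewrite -exprM mulnC exprM; congr (_ ^+ _); rewrite expr2; lra.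
have : (2 ^+ k) ^+ 2 <= (2 * (1 + normc (x 0 n))) ^+ 2.
  by rewrite ler_pXn2r// nnegrE ?exprn_ge0//; lra.
move: z0 e; move: (normc _) => t t0 e h2; have := sqr_ge0 (t - 1); nra.
Qed.

End channel.

(** * Nets of inputs *)

Section covering.
Context {R : realType}.
Local Notation C := R[i].

Lemma normc_mx_bound m n (A : 'M[C]_(m, n)) :
  exists2 be : R, 0 <= be & forall i j, normc (A i j) <= be.
Proof.
exists (\sum_i \sum_j normc (A i j)).
  by apply: sumr_ge0 => i _; apply: sumr_ge0 => j _; exact: normc_ge0.
move=> i j; rewrite (bigD1 i)//= (bigD1 j)//= -addrA lerDl addr_ge0//.
  by apply: sumr_ge0 => l _; exact: normc_ge0.
by apply: sumr_ge0 => l _; apply: sumr_ge0 => l' _; exact: normc_ge0.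
Qed.

Lemma normc_real (a : R) : 0 <= a -> normc (a%:C%C : C) = a.
Proof. by move=> a0; rewrite /= expr0n/= addr0 sqrtr_sqr ger0_norm. Qed.

Lemma normc_inv_le (c : C) : 2^-1 <= normc c -> normc c^-1 <= 2.
Proof.
by move=> h; rewrite normcV invf_ple ?posrE//; apply: lt_le_trans h;
  rewrite invr_gt0.
Qed.

Lemma mul_mx_diagE m n (A : 'M[C]_(m, n)) (d : 'rV[C]_n) i j :
  (A *m diag_mx d) i j = A i j * d 0 j.
Proof. by rewrite mul_mx_diag mxE. Qed.

(** Coordinate [i.1], meant to be the largest, is pinned at [2 ^ k] instead of ranging over a grid:
    this removes one of the [N] factors [4 ^ k] from the size of the net. *)
Definition netpt (N' k : nat)
    (i : 'I_N'.+1 * {ffun 'I_N' -> 'I_(26 * 2 ^ k) * 'I_(26 * 2 ^ k)}) :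
      'rV[C]_N'.+1 :=
  \row_n (if unlift i.1 n is Some j then gridpt (i.2 j) else (2 ^+ k)%:C%C).

Lemma exists_netpt (N' : nat) (x : 'rV[C]_N'.+1) :
  exists (k : nat) (c : C) i, [/\ 2^-1 <= normc c <= 1,
   4 ^+ k <= 8 * (1 + energy x) &
   forall n, normc (x 0 n - c * netpt (N' := N') (k := k) i 0 n) <= 2].
Proof.
pose n0 := [arg max_(n > ord0) normc (x 0 n)]%O.
have n0max n : normc (x 0 n) <= normc (x 0 n0).
  by rewrite /n0; case: arg_maxP => // n1 _; apply.
have [k [c [/andP[c1 c2] zc k2 zk]]] := exists_dyadic (x 0 n0).
have cp : 0 < normc c by rewrite (lt_le_trans _ c1).
have cn0 : c != 0 by apply: contraTneq cp => ->; rewrite normc0 ltxx.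
have /boolp.choice[phi phiP] (j : 'I_N') :
    exists t, normc (x 0 (lift n0 j) / c - gridpt (k := k) t) <= 2.
  (* Dividing by [c] at most doubles the modulus, whence the range [2 * 2 ^+ k] of the grid. *)
  apply: exists_gridpt; rewrite normcM mulrC.
  apply: ler_pM; rewrite ?normc_ge0 ?normc_inv_le//.
  exact: le_trans (n0max _) zk.
exists k, c, (n0, finfun phi); split.
- by rewrite c1 c2.
- exact: four_pow k2.
move=> n; rewrite mxE /=; case: unliftP => [j ->|->]; last exact: zc.
rewrite ffunE; have -> : x 0 (lift n0 j) - c * gridpt (phi j) =
    c * (x 0 (lift n0 j) / c - gridpt (phi j)) by rewrite mulrBr [c * (_ / _)]mulrC mulfVK.
by rewrite normcM -[leRHS]mul1r ler_pM ?normc_ge0.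
Qed.

(** The scalar [c] is absorbed by the fading, and the remainder [x - c x'] by the additive noise. *)
Lemma chan_lop N M Q (Pm : 'M[C]_(N, Q)) (x x' : 'rV[C]_N) (c : C) (v : vec R _) :
  chan (M := M) Pm x v =
  chan Pm x' (lop c%:M (Pm^T *m diag_mx (x - c *: x')) v).
Proof.
have key : Pm^T *m diag_mx x = c%:M *m (Pm^T *m diag_mx x') +
    Pm^T *m diag_mx (x - c *: x') *m 1%:M.
  apply/matrixP => q n; rewrite mulmx1 mul_scalar_mx [RHS]mxE [X in _ = X + _]mxE.
  by rewrite !mul_mx_diagE !mxE; ring.
by rewrite /chan lout_lop -key.
Qed.

Lemma covered_pred (N M Q : nat) (Pm : 'M[C]_(N, Q)) : (0 < N)%N ->
  covered (M := M) Pm N.-1.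
Proof.
case: N Pm => // N' Pm _ /=.
have [be be0 Pbe] := normc_mx_bound Pm.
have [K [k1 [K0 k11 hdom]]] := @dom_lop R N'.+1 M Q (2 + be * 2).
pose Ix k := ('I_N'.+1 * {ffun 'I_N' -> 'I_(26 * 2 ^ k) * 'I_(26 * 2 ^ k)})%type : finType.
have [d dE] : exists d : R, d = 26%:R by exists 26%:R.
have d0 : 0 <= d by rewrite dE.
(* A grid has [26 ^ 2 * 4 ^ k] points and [4 ^ k <= 8 (1 + E)], so each of the [N'] free coordinates
   takes at most [D (1 + E)] values. *)
pose D := d ^+ 2 * 8.
have D0 : 0 <= D by rewrite mulr_ge0// sqr_ge0.
pose c0 : R := 8 + N'.+1%:R * D ^+ N' * K.
have c0' : 0 <= N'.+1%:R * D ^+ N' * K.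
  by apply: mulr_ge0 => //; apply: mulr_ge0 => //; exact: exprn_ge0.
pose L k (i : Ix k) (v :
  vec R ((('I_M * 'I_Q) * bool) + (('I_M * 'I_N'.+1) * bool))) :=
  chan (M := M) Pm (netpt i) (fun l => k1 * v l).
(* The exponent [0]: this net costs no polynomial factor in the level. *)
exists Ix, L, c0, 0%N.
split.
- by rewrite /c0; lra.
- move=> k i; exact: (measurableT_comp (measurable_lout _ _) (measurable_scaleop _)).
move=> x; have [k [c [i [/andP[c1 c2] k4 xc]]]] := exists_netpt x.
have e1 := energy_ge0 x.
exists k, i, K; split => //.
- apply: (le_trans (expR_le4 k)); apply: (le_trans k4).
  by rewrite ler_wpM2r ?addr_ge0// /c0 lerDl.
- rewrite expr0 mulr1 card_prod card_ffun !card_prod !card_ord.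
  have -> : (N'.+1 * (26 * 2 ^ k * (26 * 2 ^ k)) ^ N')%:R =
      N'.+1%:R * (d ^+ 2 * 4 ^+ k) ^+ N' :> R.
    rewrite natrM natrX; congr (_ * _ ^+ _).
    have -> : 4 = 2 * 2 :> R by rewrite -natrM.
    by rewrite exprMn !natrM natrX -dE; ring.
  have -> : c0 * (1 + energy x) ^+ N' = 8 * (1 + energy x) ^+ N' +
      N'.+1%:R * (D * (1 + energy x)) ^+ N' * K.
    by rewrite exprMn /c0; ring.
  apply: (@le_trans _ _ (N'.+1%:R * (D * (1 + energy x)) ^+ N' * K)); last first.
    by rewrite lerDr mulr_ge0// exprn_ge0// addr_ge0.
  apply: ler_wpM2r => //; apply: ler_wpM2l => //.
  have dk : d ^+ 2 * 4 ^+ k <= D * (1 + energy x).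
    by rewrite /D -mulrA; apply: ler_wpM2l => //; exact: sqr_ge0.
  apply: lerXn2r => //; rewrite nnegrE; last by apply: mulr_ge0 => //;
    exact: addr_ge0.
  by apply: mulr_ge0; [exact: sqr_ge0|exact: exprn_ge0].
move=> g B gg mB.
pose Bm := Pm^T *m diag_mx (x - c *: netpt i).
have cn0 : c != 0.
  by apply: contraTneq c1 => ->; rewrite normc0 -ltNge invr_gt0.
have hd : dom K k1 (lop (M := M) c%:M Bm).
  apply: (hdom _ (c^-1%:M)).
  - by rewrite -scalar_mxM mulVf.
  - move=> a b; rewrite mxE; case: (a == b); rewrite ?mulr0n ?normc0 ?mulr1n.
      by rewrite (le_trans c2)// -[leLHS]addr0 lerD ?ler1n// mulr_ge0.
    by rewrite addr_ge0// mulr_ge0.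
  - move=> a b; rewrite mxE; case: (a == b); rewrite ?mulr0n ?normc0 ?mulr1n.
      by rewrite (le_trans (normc_inv_le c1))// lerDl mulr_ge0.
    by rewrite addr_ge0// mulr_ge0.
  - move=> a b; rewrite mul_mx_diagE !mxE normcM.
    apply: (@le_trans _ _ (be * 2)); last by rewrite lerDr.
    by rewrite ler_pM ?normc_ge0//; have := xc b; rewrite mxE.
have -> : chan Pm x @^-1` B = (lout (Pm^T *m diag_mx (netpt i)) 1%:M \o
    lop (M := M) c%:M Bm) @^-1` B.
  by apply/seteqP; split => v /=; rewrite (chan_lop Pm x (netpt i) c).
by apply: dom_preimage => //; exact: linop_lop.
Qed.

Lemma upscale_preimage (I : finType) (g : probability (vec R I) R) (s : I -> R)
    (B : set (vec R I)) : gaussian g -> (forall i, 1 <= s i) -> measurable B ->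
  (g B <= (\prod_i s i)%:E * g ((fun v i => s i * v i)%R @^-1` B))%E.
Proof.
move=> gg s1 mB.
have mS : measurable_fun setT (fun v : vec R I => (fun i => s i * v i) : vec R I).
  apply: measurable_vecP => i; apply: measurable_funM => //;
    exact: measurable_coord.
have mB' : measurable ((fun v : vec R I => (fun i => s i * v i) :
  vec R I) @^-1` B).
  by rewrite -[X in measurable X]setTI; exact: mS.
have := @gaussian_upscale R I g (fun v => (\1_B v)%:E) s gg s1.
rewrite integral_indic// setIT => h.
apply: (le_trans (h _ _)).
- by apply/measurable_EFinP; exact: measurable_indic.
- by move=> v; rewrite lee_fin.
rewrite le_eqVlt; apply/orP; left; apply/eqP; congr (_ * _)%E.
transitivity (\int[g]_v
  (\1_((fun v : vec R I => (fun i => s i * v i) :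
    vec R I) @^-1` B) v)%:E)%E => //.
by rewrite integral_indic// setIT.
Qed.

(** In the columns of the chosen rows, the matrix of these rows is invertible, so the fading absorbs
    the scalars [c] of modulus in [[1/2, 1]] of all these coordinates independently. In every other
    column, once the noise is inflated to the size [2 ^ k] of the coordinate, the whole signal is a
    bounded perturbation, which [lop] removes. *)
Lemma covered_block (N M Q : nat) (Pm : 'M[C]_(N, Q)) : \rank Pm = Q ->
  covered (M := M) Pm (M * (N - Q)).
Proof.
move=> rkP; have fullP : row_full Pm by rewrite /row_full rkP.
have [f finj] : exists2 f : 'I_Q -> 'I_N, injective f & rowsub f Pm \in unitmx.
  exists (fullrankfun fullP); [exact: fullrankfun_inj|exact: fullrowsub_unit].
set Bq := rowsub f Pm => Bu.
pose inJ (n : 'I_N) := n \in codom f.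
have cardJ : #|[pred n | ~~ inJ n]| = (N - Q)%N.
  have <- : #|[pred n | inJ n]| = Q by rewrite (card_codom finj) card_ord.
  by rewrite -[X in (X - _)%N]card_ord -(cardC [pred n | inJ n]) addKn.
have [be be0 Pbe] := normc_mx_bound Pm.
have [bi bi0 Pbi] := normc_mx_bound (invmx Bq^T).
have [K [k1 [K0 k11 hdom]]] := @dom_lop R N M Q (be * 2 + bi * 2).
(* An index lists [N] dyadic exponents up to the level, so there are [k.+1 ^ N] of them, a
   polynomial in [k]. *)
pose Ix (k : nat) : finType := {ffun 'I_N -> 'I_k.+1}.
pose F (k : nat) (i : Ix k) : 'M[C]_(Q, N) :=
  \matrix_(q, n) (if n == f q then (2 ^+ i n)%:C%C else 0).
pose dg (k : nat) (i : Ix k) (n : 'I_N) : R := if inJ n then 1 else 2 ^+ i n.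
pose D (k : nat) (i : Ix k) : 'M[C]_N := diag_mx (\row_n (dg k i n)%:C%C).
pose L k (i : Ix k) (v :
  vec R ((('I_M * 'I_Q) * bool) + (('I_M * 'I_N) * bool))) :=
  lout (F k i) (D k i) (fun l => k1 * v l).
pose a := (M * (N - Q))%N.
have [e8 e8E] : exists e8 : R, e8 = 8 by exists 8.
have e80 : 0 <= e8 by rewrite e8E.
pose c0 : R := 1 + e8 + K * e8 ^+ a.
have c0' : 0 <= K * e8 ^+ a by rewrite mulr_ge0// exprn_ge0.
exists Ix, L, c0, N; split.
- by rewrite /c0; apply: ltr_pwDl => //; rewrite ltr_pwDl.
- move=> k i; exact: (measurableT_comp (measurable_lout _ _) (measurable_scaleop _)).
move=> x; have e0 := energy_ge0 x.
have /boolp.choice[kc kcP] (n : 'I_N) : exists kc : nat * C,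
  [/\ 2^-1 <= normc kc.2 <= 1, normc (x 0 n - kc.2 * (2 ^+ kc.1)%:C%C) <= 2,
      2 ^+ kc.1 <= 2 * (1 + normc (x 0 n)) & normc (x 0 n) <= 2 ^+ kc.1].
  by have [k [c h]] := exists_dyadic (x 0 n); exists (k, c).
pose j := \max_n (kc n).1.
have kj n : ((kc n).1 < j.+1)%N by rewrite ltnS; exact: leq_bigmax.
pose i : Ix j := [ffun n => Ordinal (kj n)].
pose Z := e8 * (1 + energy x).
have Z0 : 0 <= Z by rewrite mulr_ge0// addr_ge0.
have kZ n : 4 ^+ (kc n).1 <= Z.
  by have [_ _ h _] := kcP n; rewrite /Z e8E; exact: four_pow h.
have Z1 : 1 <= Z.
  by rewrite /Z -[leLHS]mulr1 ler_pM// ?lerDl// e8E ler1n.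
exists j, i, (Z ^+ a * K); split.
- by rewrite mulr_ge0// exprn_ge0.
- apply: (@le_trans _ _ Z); last first.
    by rewrite /Z ler_wpM2r ?addr_ge0// /c0 -addrA addrCA lerDl addr_ge0.
  apply: (le_trans (expR_le4 _)).
  rewrite /j; apply: (big_ind (fun m => 4 ^+ m <= Z)) => //.
  by move=> m n mZ nZ; rewrite /maxn; case: ifP.
- rewrite card_ffun !card_ord natrX /Z exprMn.
  have -> : c0 * j.+1%:R ^+ N * (1 + energy x) ^+ a = (1 + e8) * j.+1%:R ^+ N *
      (1 + energy x) ^+ a + j.+1%:R ^+ N * (e8 ^+ a * (1 + energy x) ^+ a * K).
    by rewrite /c0; ring.
  by rewrite lerDr !mulr_ge0// ?exprn_ge0 ?addr_ge0.
move=> g B gg mB.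
have dg1 n : 1 <= dg j i n.
  by rewrite /dg; case: ifP => // _; rewrite exprn_ege1// ler1n.
pose s (l : (('I_M * 'I_Q) * bool) + (('I_M * 'I_N) * bool)) : R :=
  match l with inl _ => 1 | inr mnb => dg j i mnb.1.2 end.
have s1 l : 1 <= s l by case: l => l; [exact: lexx|exact: dg1].
have mchan : measurable (chan (M := M) Pm x @^-1` B).
  by rewrite -[X in measurable X]setTI; exact: measurable_lout.
(* A complex entry has two real coordinates, so an inflated column contributes [4 ^ k], at most [Z],
   in each of the [M] rows; the columns in the image of [f] contribute [1]. *)
have prods : \prod_l s l <= Z ^+ a.
  rewrite big_sumType /= big1 ?mul1r//.
  rewrite -(pair_bigA _ (fun mn (_ : bool) => dg j i mn.2)) /=.
  rewrite -(pair_bigA _ (fun (_ : 'I_M) n => \prod_(b : bool) dg j i n)) /=.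
  rewrite prodr_const card_ord /a mulnC exprM.
  have p0 : 0 <= \prod_(n < N) \prod_(b : bool) dg j i n.
    by apply: prodr_ge0 => n _; apply: prodr_ge0 => b _; exact: le_trans (dg1 n).
  apply: lerXn2r; rewrite ?nnegrE ?exprn_ge0//.
  rewrite -cardJ -prodr_const [leRHS]big_mkcond /=.
  apply: ler_prod => n _; rewrite big_bool /=.
  have d0 : 0 <= dg j i n by exact: le_trans (dg1 n).
  rewrite mulr_ge0//= unfold_in /= /dg; case: ifP => _ /=; first by rewrite mulr1.
  by rewrite ffunE /= -exprMn; apply: le_trans (kZ n); rewrite -natrM.
apply: (le_trans (upscale_preimage gg s1 mchan)).
(* The inverse [A'] is bounded independently of [x]: the chosen rows are fixed once and for all, and
   the scalars have modulus at least [1/2]. *)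
pose A : 'M[C]_Q := Bq^T *m diag_mx (\row_q (kc (f q)).2).
pose A' : 'M[C]_Q := diag_mx (\row_q (kc (f q)).2^-1) *m invmx Bq^T.
(* The rounding error in the chosen columns, the ratio of the coordinate to its dyadic size in the
   others; both have modulus at most [2]. *)
pose en (n : 'I_N) : C := if inJ n then x 0 n - (kc n).2 * (2 ^+ (kc n).1)%:C%C
  else x 0 n / (2 ^+ (kc n).1)%:C%C.
pose Bm := Pm^T *m diag_mx (\row_n en n).
have two_neq0 (m : nat) : (2 ^+ m)%:C%C != 0 :> C.
  by apply/eqP => /complexI/eqP; rewrite gt_eqF// exprn_gt0.
have key : Pm^T *m diag_mx x = A *m F j i + Bm *m D j i.
  apply/matrixP => q n; rewrite [RHS]mxE !mul_mx_diagE [in LHS]mxE !mxE.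
  under eq_bigr do rewrite mul_mx_diagE !mxE.
  rewrite /en /dg; have [/codomP[q0 nq0]|nJ] := boolP (inJ n).
    rewrite (bigD1 q0)//= nq0 eqxx big1 ?addr0; last first.
      move=> q1 q1q0; case: eqP => [/finj q01|_]; last by rewrite mulr0.
      by rewrite -q01 eqxx in q1q0.
    rewrite ffunE /= (_ : 1%:C%C = 1)// mulr1.
    by rewrite mulrBr !mulrA addrCA subrr addr0.
  rewrite big1 ?add0r; last first.
    move=> q1 _; case: eqP => [nf|_]; last by rewrite mulr0.
    by rewrite /inJ nf codom_f in nJ.
  by rewrite ffunE /= -mulrA mulfVK.
have ecn n : normc (en n) <= 2.
  have [_ h2 _ h4] := kcP n; rewrite /en; case: ifP => // _.
  rewrite normcM normcV normc_real ?exprn_ge0// ler_pdivrMr ?exprn_gt0//.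
  by apply: (le_trans h4); rewrite ler_peMl ?exprn_ge0// ler1n.
have hd : dom K k1 (lop (M := M) A Bm).
  apply: (hdom _ A').
  - rewrite /A /A' mulmxA -(mulmxA _ (invmx _)) mulVmx ?unitmx_tr// mulmx1.
    apply/matrixP => p q; rewrite mul_mx_diagE !mxE.
    case: eqP => [->|_]; rewrite ?mulr0n ?mul0r// !mulr1n mulVf//.
    have [/andP[h _] _ _ _] := kcP (f q).
    by apply: contraTneq h => ->; rewrite normc0 -ltNge invr_gt0.
  - move=> p q; rewrite mul_mx_diagE !mxE normcM.
    apply: (@le_trans _ _ (be * 2)); last by rewrite lerDl mulr_ge0.
    rewrite ler_pM ?normc_ge0//; have [/andP[_ h] _ _ _] := kcP (f q).
    by rewrite (le_trans h)// ler1n.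
  - move=> p q; rewrite /A' mul_diag_mx !mxE normcM mulrC.
    apply: (@le_trans _ _ (bi * 2)); last by rewrite lerDr mulr_ge0.
    rewrite ler_pM ?normc_ge0//; have [/andP[h _] _ _ _] := kcP (f p).
    exact: normc_inv_le.
  - move=> p n; rewrite mul_mx_diagE !mxE normcM.
    apply: (@le_trans _ _ (be * 2)); last by rewrite lerDl mulr_ge0.
    by rewrite ler_pM ?normc_ge0.
have Ss v : Smx (N := N) (M := M) (Q := Q) (fun l => s l * v l) = Smx v.
  by apply/matrixP => m q; rewrite !mxE /= !mul1r.
have Ws v : Wmx (N := N) (M := M) (Q := Q) (fun l => s l * v l) = Wmx v *m D j i.
  apply/matrixP => m n; rewrite mul_mx_diagE !mxE /=.
  by apply/eqP; rewrite eq_complex /= !mulr0 subr0 add0r mulrC eqxx mulrC eqxx.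
have -> : (fun v l => s l * v l) @^-1` (chan Pm x @^-1` B) =
    (lout (F j i) (D j i) \o lop (M := M) A Bm) @^-1` B.
  apply/seteqP; split => v /=; rewrite lout_lop -key /chan /lout Ss Ws mulmx1;
  exact.
have Za0 : (0 <= (Z ^+ a)%:E)%E by rewrite lee_fin exprn_ge0.
rewrite EFinM -muleA.
apply: (@le_trans _ _ ((Z ^+ a)%:E *
    g ((lout (F j i) (D j i) \o lop (M := M) A Bm) @^-1` B))%E).
  by apply: lee_wpmul2r; [exact: measure_ge0|rewrite lee_fin].
apply: lee_wpmul2l => //.
by apply: dom_preimage => //; exact: linop_lop.
Qed.

End covering.

(** * A bound on the mutual information *)

Section mutual_information_bound.
Context {d : measure_display} {T : measurableType d} {R : realType}.
Variable P : probability T R.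

Lemma fin_partition_trivIset (F : set (set T)) k (A : 'I_k -> set T) (C : set T) :
  fin_partition F A -> trivIset setT (fun i => A i `&` C).
Proof.
move=> [_ dA _]; apply/trivIsetP => i j _ _ ij.
by rewrite setIACA dA// set0I.
Qed.

Lemma fin_partition_bigsetU (F : set (set T)) k (A : 'I_k -> set T) (C : set T) :
  fin_partition F A -> \big[setU/set0]_(i < k) (A i `&` C) = C.
Proof.
move=> [_ _ UA]; rewrite -bigcup_seq -setI_bigcupl.
rewrite (_ : \bigcup_(_ in _) _ = setT) ?setTI// -UA.
by apply/seteqP; split => t [i _ At]; exists i => //=; rewrite mem_index_enum.
Qed.

Lemma fin_partition_integral (F : set (set T)) k (A : 'I_k -> set T) (C : set T)
    (f : T -> \bar R) : F `<=` measurable -> measurable C -> fin_partition F A ->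
  measurable_fun setT f -> (forall t, 0 <= f t)%E ->
  (\int[P]_(t in C) f t = \sum_(i < k) \int[P]_(t in A i `&` C) f t)%E.
Proof.
move=> mF mC pA mf f0; rewrite -{1}(fin_partition_bigsetU C pA).
rewrite ge0_integral_bigsetU//.
- by move=> i; apply: measurableI => //; apply: mF; case: pA.
- exact: index_enum_uniq.
- by apply: (sub_trivIset (@subsetT _ _)); exact: fin_partition_trivIset pA.
- exact: measurable_funTS.
Qed.

Lemma fin_partition_measure (F : set (set T)) k (A : 'I_k -> set T) (C : set T) :
  F `<=` measurable -> measurable C -> fin_partition F A ->
  (P C = \sum_(i < k) P (A i `&` C))%E.
Proof.
move=> mF mC pA; rewrite -{1}(fin_partition_bigsetU C pA).
rewrite measure_bigsetU_ord//.
  by move=> i; apply: measurableI => //; apply: mF; case: pA.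
exact: fin_partition_trivIset pA.
Qed.

Local Notation p A := (fine (P A)).

(* The tangent line of [expR] at [- ln (p (A `&` B) / (p A * p B))] replaces
   Jensen's inequality. *)
Lemma xlogterm_le (psi : T -> R) (A B : set T) (r : R) :
  measurable A -> measurable B -> measurable_fun setT psi -> (forall t, 0 <= psi t) ->
  (\int[P]_(t in A `&` B) (psi t)%:E < +oo)%E ->
  (\int[P]_(t in A `&` B) (expR (- psi t))%:E <= P A * r%:E)%E ->
  xlogterm (p (A `&` B)) (p A) (p B) <=
  fine (\int[P]_(t in A `&` B) (psi t)%:E) + p (A `&` B) * (r / p B - 1).
Proof.
move=> mA mB mpsi psi0 ioo h.
have mAB : measurable (A `&` B) by exact: measurableI.
have PE C : measurable C -> P C = (p C)%:E.
  by move=> mC; rewrite fineK// fin_num_measure.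
have i0 : (0 <= \int[P]_(t in A `&` B) (psi t)%:E)%E.
  by apply: integral_ge0 => t _; rewrite lee_fin.
have iE : (\int[P]_(t in A `&` B) (psi t)%:E)%E =
    (fine (\int[P]_(t in A `&` B) (psi t)%:E)%E)%:E.
  by rewrite fineK// ge0_fin_numE.
move: iE i0; set J := fine _ => iE; rewrite iE lee_fin => J0.
have p0 C : 0 <= p C by rewrite fine_ge0.
rewrite /xlogterm; case: eqP => [->|/eqP pn0]; first by rewrite mul0r addr0.
have pp : 0 < p (A `&` B) by rewrite lt_neqAle eq_sym pn0 p0.
have ple C : measurable C -> A `&` B `<=` C -> 0 < p C.
  move=> mC sC; apply: (lt_le_trans pp); rewrite fine_le ?fin_num_measure//.
  by apply: le_measure => //; rewrite inE.
have pA : 0 < p A by apply: ple => // t [].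
have pB : 0 < p B by apply: ple => // t [].
move: h; rewrite (PE A)// -EFinM => h.
set q := p (A `&` B) in pp pn0 *.
set al := ln (q / (p A * p B)).
have ea : expR (- al) = p A * p B / q.
  by rewrite expRN lnK ?posrE ?divr_gt0 ?mulr_gt0// invf_div.
pose e := expR (- al).
have e0 : 0 < e by exact: expR_gt0.
(* The tangent inequality [expR (- psi) >= e * (1 + al - psi)], integrated over the intersection of
   [A] and [B]. *)
have key : e * (1 + al) * q <= p A * r + e * J.
  (* A negative [1 + al] makes the left side nonpositive, so nonnegative integrals are compared only
     in the other case. *)
  have [neg|pos] := ltP (1 + al) 0.
    apply: (@le_trans _ _ 0).
      by rewrite -mulrA mulr_ge0_le0 ?(ltW e0)// mulr_le0_ge0 ?ltW.
    apply: addr_ge0; last by rewrite mulr_ge0// ltW.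
    rewrite -lee_fin; apply: le_trans h; apply: integral_ge0 => t _.
    by rewrite lee_fin expR_ge0.
  rewrite -lee_fin EFinD (EFinM e J) -iE.
  have me : measurable_fun (A `&` B) (fun t => (expR (- psi t))%:E).
    apply: measurable_funTS; apply/measurable_EFinP.
    by apply: measurableT_comp => //; exact: measurableT_comp.
  have mp : measurable_fun (A `&` B) (fun t => (psi t)%:E).
    by apply: measurable_funTS; exact/measurable_EFinP.
  rewrite -ge0_integralZl//; last 2 first.
  - by move=> t _; rewrite lee_fin.
  - by rewrite lee_fin ltW.
  apply: (@le_trans _ _ (\int[P]_(t in A `&` B) (expR (- psi t))%:E +
     \int[P]_(t in A `&` B) (e%:E * (psi t)%:E))%E); last by rewrite leeD2r.
  have mpe : measurable_fun (A `&` B) (fun t => e%:E * (psi t)%:E)%E.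
    exact: measurable_funeM.
  have pe0 t : (0 <= e%:E * (psi t)%:E)%E by rewrite -EFinM lee_fin mulr_ge0// ltW.
  have ee0 t : (0 <= (expR (- psi t))%:E)%E by rewrite lee_fin expR_ge0.
  rewrite -(ge0_integralD P mAB (fun t _ => ee0 t) me (fun t _ => pe0 t) mpe).
  rewrite EFinM -(PE _ mAB) -integral_cst//.
  apply: ge0_le_integral => //.
  - by move=> t _; rewrite lee_fin mulr_ge0// ltW.
  - by apply: emeasurable_funD => //; exact: measurable_funeM.
  move=> t _; rewrite /= -EFinM -EFinD lee_fin -lerBlDr -mulrBr.
  have -> : expR (- psi t) = e * expR (al - psi t).
    by rewrite /e -expRD addrA addNr add0r.
  by rewrite ler_pM2l// -addrA expR_ge1Dx.
(* Since [e * q] is [p A * p B], division by [e] turns [p A * r] into [q * r / p B]. *)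
rewrite -(ler_pM2l e0); have -> : e * (J + q * (r / p B - 1)) =
    p A * r + e * J - e * q.
  by rewrite mulrDr /e ea; field; rewrite !gt_eqF.
rewrite lerBrDr (le_trans _ key)// le_eqVlt; apply/orP; left; apply/eqP.
by rewrite /al; ring.
Qed.

(** Summing the termwise bound over [i] leaves a correction of at most the sum of the
    [r j - p (B j)], which is nonpositive because [r] has total mass at most [1]. *)
Lemma partition_MI_le (F G : set (set T)) (psi : T -> R) k l
    (A : 'I_k -> set T) (B : 'I_l -> set T) (r : 'I_l -> R) :
  F `<=` measurable -> G `<=` measurable ->
  measurable_fun setT psi -> (forall t, 0 <= psi t) ->
  (\int[P]_t (psi t)%:E < +oo)%E ->
  fin_partition F A -> fin_partition G B ->
  (forall j, 0 <= r j) -> \sum_j r j <= 1 ->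
  (forall i j,
    \int[P]_(t in A i `&` B j) (expR (- psi t))%:E <= P (A i) * (r j)%:E)%E ->
  ((partition_MI P A B)%:E <= \int[P]_t (psi t)%:E)%E.
Proof.
move=> mF mG mpsi psi0 ioo pA pB r0 r1 hr.
have mA i : measurable (A i) by apply: mF; case: pA.
have mB j : measurable (B j) by apply: mG; case: pB.
have mAB i j : measurable (A i `&` B j) by exact: measurableI.
have mpsi' : measurable_fun setT (fun t => (psi t)%:E) by exact/measurable_EFinP.
have psi0' t : (0 <= (psi t)%:E)%E by rewrite lee_fin.
have ioo' C : measurable C -> (\int[P]_(t in C) (psi t)%:E < +oo)%E.
  by move=> mC; apply: le_lt_trans ioo; apply: ge0_subset_integral.
have sumI : (\int[P]_t (psi t)%:E =
    \sum_(i < k) \sum_(j < l) \int[P]_(t in A i `&` B j) (psi t)%:E)%E.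
  rewrite (fin_partition_integral mF _ pA mpsi' psi0')//; apply: eq_bigr => i _.
  rewrite setIT (fin_partition_integral mG _ pB mpsi' psi0')//.
  by apply: eq_bigr => j _; rewrite setIC.
have finI i j : (\int[P]_(t in A i `&` B j) (psi t)%:E =
   (fine (\int[P]_(t in A i `&` B j) (psi t)%:E))%:E)%E.
  by rewrite fineK// ge0_fin_numE ?ioo'// integral_ge0.
have sumP j : \sum_(i < k) p (A i `&` B j) = p (B j).
  apply: EFin_inj; rewrite -sumEFin fineK ?fin_num_measure//.
  rewrite (fin_partition_measure mF _ pA)//; apply: eq_bigr => i _.
  by rewrite fineK// fin_num_measure.
have sumB : \sum_(j < l) p (B j) = 1.
  apply: EFin_inj; rewrite -sumEFin -(@probability_setT _ _ _ P).
  rewrite (fin_partition_measure mG measurableT pB); apply: eq_bigr => j _.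
  by rewrite setIT fineK// fin_num_measure.
rewrite sumI; under eq_bigr do under eq_bigr do rewrite finI.
under eq_bigr do rewrite sumEFin.
rewrite sumEFin lee_fin /partition_MI.
apply: (@le_trans _ _ (\sum_(i < k) \sum_(j < l)
  (fine (\int[P]_(t in A i `&` B j) (psi t)%:E)%E +
   p (A i `&` B j) * (r j / p (B j) - 1)))).
  apply: ler_sum => i _; apply: ler_sum => j _.
  by apply: xlogterm_le => //; exact: ioo'.
under eq_bigr do rewrite big_split/=.
rewrite big_split/= gerDl exchange_big/=.
under eq_bigr do rewrite -mulr_suml sumP.
apply: (@le_trans _ _ (\sum_(j < l) (r j - p (B j)))).
  apply: ler_sum => j _.
  (* A null [B j] contributes [0], which is at most [r j]. *)
  have [->|b0] := eqVneq (p (B j)) 0; first by rewrite mul0r subr0.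
  by rewrite mulrBr mulr1 mulrCA divff// mulr1.
by rewrite sumrB sumB subr_le0.
Qed.

(** [r j] stands for the mass of [B j] under the reference subprobability. Integration over events
    of the input replaces conditional laws given the input; [r] may depend on the output partition
    but not on the input one. *)
Lemma mutual_info_le (F G : set (set T)) (psi : T -> R) :
  F `<=` measurable -> G `<=` measurable ->
  measurable_fun setT psi -> (forall t, 0 <= psi t) ->
  (forall l (B : 'I_l -> set T), fin_partition G B -> exists r : 'I_l -> R,
    [/\ forall j, 0 <= r j, \sum_j r j <= 1 & forall A j, F A ->
    (\int[P]_(t in A `&` B j) (expR (- psi t))%:E <= P A * (r j)%:E)%E]) ->
  (mutual_info P F G <= \int[P]_t (psi t)%:E)%E.
Proof.
move=> mF mG mpsi psi0 hr.
have [ioo|] := ltP (\int[P]_t (psi t)%:E)%E +oo%E; last first.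
  by rewrite leye_eq => /eqP ->; rewrite leey.
apply: ge_ereal_sup => _ [k [l [A [B [pA pB ->]]]]].
have [r [r0 r1 rAB]] := hr l B pB.
apply: (partition_MI_le mF mG mpsi psi0 ioo pA pB r0 r1) => i j.
by apply: rAB; case: pA.
Qed.

End mutual_information_bound.

(** * Mixtures *)

Section mixture.
Context {R : realType} {N M Q : nat}.
Local Notation C := R[i].
Local Notation I := ((('I_M * 'I_Q) * bool) + (('I_M * 'I_N) * bool))%type.
Local Notation O := (('I_M * 'I_N) * bool)%type.
Local Notation V := (vec R I).

Section weights.
Variables (Ix : nat -> finType) (L : forall k, Ix k -> V -> vec R O) (q : R).
Hypothesis mL : forall k (i : Ix k), measurable_fun setT (L i).
Hypothesis q01 : 0 < q < 1.

Implicit Types (g : probability V R) (B : set (vec R O)).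

(** Geometric over the levels and uniform within a level. An empty level gets weight [0], by the
    convention on division by zero. *)
Let w k : R := (1 - q) * q ^+ k / #|Ix k|%:R.

Definition mixture (g : probability V R) (B : set (vec R O)) : \bar R :=
  (\sum_(k <oo) (w k)%:E * \sum_(i : Ix k) g (L i @^-1` B))%E.

Let w0 k : 0 <= w k.
Proof.
case/andP: q01 => q0 q1.
by rewrite /w mulr_ge0 ?invr_ge0// mulr_ge0 ?exprn_ge0 ?subr_ge0// ltW.
Qed.

Let term_ge0 g B k : (0 <= (w k)%:E * \sum_(i : Ix k) g (L i @^-1` B))%E.
Proof.
by apply: mule_ge0; [rewrite lee_fin|apply: sume_ge0 => i _; exact: measure_ge0].
Qed.

Lemma mixture_ge0 g B : (0 <= mixture g B)%E.
Proof. by apply: nneseries_ge0 => k _ _; exact: term_ge0. Qed.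

Lemma mixture_ge g B k (i : Ix k) : ((w k)%:E * g (L i @^-1` B) <= mixture g B)%E.
Proof.
apply: (@le_trans _ _ ((w k)%:E * \sum_(i : Ix k) g (L i @^-1` B))%E).
  apply: lee_wpmul2l; first by rewrite lee_fin.
  rewrite (bigD1 i)//= leeDl//; apply: sume_ge0 => j _; exact: measure_ge0.
rewrite /mixture (@nneseriesD1 R _ k xpredT)//.
by rewrite leeDl//; apply: nneseries_ge0 => j _ _; exact: term_ge0.
Qed.

Lemma mixture_sum_le1 g l (B : 'I_l -> set (vec R O)) :
  (forall j, measurable (B j)) -> (forall i j, i != j -> B i `&` B j = set0) ->
  (\sum_j mixture g (B j) <= 1)%E.
Proof.
move=> mB dB; case/andP: (q01) => q0 q1.
rewrite -nneseries_sum; last by move=> j k _; exact: term_ge0.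
apply: (@le_trans _ _ (\sum_(k <oo) ((1 - q) * q ^+ k)%:E)%E).
  apply: lee_nneseries => k _; first by rewrite sume_ge0// => j _;
    exact: term_ge0.
  rewrite -ge0_sume_distrr; last first.
    by move=> j _; apply: sume_ge0 => i _; exact: measure_ge0.
  rewrite exchange_big/=.
  have h (i : Ix k) : (\sum_(j < l) g (L i @^-1` B j) <= 1)%E.
    rewrite -measure_bigsetU_ord.
    - apply: probability_le1; apply: bigsetU_measurable => j _.
      by rewrite -[X in measurable X]setTI; exact: mL.
    - by move=> j; rewrite -[X in measurable X]setTI; exact: mL.
    - by apply/trivIsetP => a b _ _ ab; rewrite -preimage_setI dB.
  apply: (@le_trans _ _ ((w k)%:E * \sum_(i : Ix k) 1)%E).
    by rewrite lee_wpmul2l ?lee_fin// lee_sum.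
  rewrite sumEFin sumr_const -EFinM lee_fin -[1 *+ _]/(#|Ix k|%:R) /w.
  have [->|n0] := eqVneq (#|Ix k|%:R : R) 0.
    by rewrite mulr0 mulr_ge0 ?subr_ge0 ?exprn_ge0// ltW.
  by rewrite mulfVK.
apply: lime_le.
  apply: is_cvg_nneseries => k _ _;
    rewrite lee_fin mulr_ge0 ?exprn_ge0 ?(ltW q0)//.
  by rewrite subr_ge0 ltW.
apply: nearW => n; rewrite sumEFin lee_fin.
have := @geometric_le_lim R n (1 - q) q _ q0.
rewrite subr_ge0 (ltW q1) gtr0_norm// q1 => /(_ isT isT).
by rewrite divff// subr_eq0 gt_eqF.
Qed.

End weights.

(** A point of level [k] has weight [(1 - q) * q ^+ k / #|Ix k|] in the mixture, so its price is
    [#|Ix k| * K] up to [q ^- k] and a constant. The constant precedes [g] because each admissible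
    channel brings its own noise law. *)
Lemma covered_mixture (Pm : 'M[C]_(N, Q)) (a : nat) (de : R) :
  covered (M := M) Pm a -> 0 < de -> exists2 c : R, 1 <= c &
  forall g : probability V R, gaussian g -> exists r : set (vec R O) -> R,
  [/\ forall B, 0 <= r B,
      forall l (B : 'I_l -> set (vec R O)), (forall j, measurable (B j)) ->
        (forall i j, i != j -> B i `&` B j = set0) -> \sum_j r (B j) <= 1 &
      forall x B, measurable B -> (g (chan Pm x @^-1` B) <=
        (expR (ln c + (a%:R + de) * ln (1 + energy x)) * r B)%:E)%E].
Proof.
move=> [Ix [L [c [b [c0 mL cov]]]]] de0.
(* [de] is split into halves: one pays for [q ^- k], the other for [k.+1 ^+ b], through
   [t <= eta^-1 * expR (eta * t)] raised to the power [b]. Using [b.+1] avoids division by zero. *)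
pose eta := de / 2 / b.+1%:R; pose q := expR (- (de / 2)).
have eta0 : 0 < eta by rewrite !divr_gt0.
have q0 : 0 < q by exact: expR_gt0.
have q1 : q < 1 by rewrite /q expR_lt1 oppr_lt0 divr_gt0.
pose c1 := c * eta^-1 ^+ b * expR (de / 2) / (1 - q) * expR (de * ln c).
(* A constant at least [1] has a nonnegative logarithm, which later makes [psi] nonnegative. *)
exists (Num.max 1 c1); first by rewrite le_max lexx.
move=> g gg.
have mle1 B : measurable B -> (mixture L q g B <= 1)%E.
  move=> mB; have := @mixture_sum_le1 Ix L q mL (introT andP (conj q0 q1)) g 1
    (fun _ => B) (fun _ => mB).
  rewrite big_ord1; apply => i j; by rewrite !ord1.
exists (fun B => fine (mixture L q g B)).
have q01 : 0 < q < 1 by rewrite q0.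
have r0 B : (0 <= mixture L q g B)%E by exact: mixture_ge0.
have rE B : measurable B -> mixture L q g B = (fine (mixture L q g B))%:E.
  move=> mB; rewrite fineK// ge0_fin_numE// (le_lt_trans (mle1 B mB))//.
  exact: ltry.
split.
- by move=> B; exact: fine_ge0.
- move=> l B mB dB; rewrite -lee_fin -sumEFin.
  under eq_bigr do rewrite -rE//.
  exact: mixture_sum_le1.
move=> x B mB; have [k [i [K [K0 ek IK gK]]]] := cov x.
apply: (le_trans (gK g B gg mB)).
have I0 : 0 < #|Ix k|%:R :> R by rewrite ltr0n; apply/card_gt0P; exists i.
have wq0 : 0 < (1 - q) * q ^+ k / #|Ix k|%:R.
  by rewrite divr_gt0// mulr_gt0 ?subr_gt0// exprn_gt0.
set W := _ / _ in wq0.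
have e1 : 1 <= 1 + energy x by rewrite lerDl energy_ge0.
have e0 : 0 < 1 + energy x by exact: lt_le_trans e1.
set s := ln (1 + energy x).
have Eexp : 1 + energy x = expR s by rewrite lnK.
apply: (@le_trans _ _ ((K / W)%:E * mixture L q g B)%E).
  rewrite EFinM -muleA lee_wpmul2l ?lee_fin//.
  have -> : g (L k i @^-1` B) = (W^-1%:E * (W%:E * g (L k i @^-1` B)))%E.
    by rewrite muleA -EFinM mulVf ?mul1e// gt_eqF.
  rewrite lee_wpmul2l ?lee_fin ?invr_ge0 ?(ltW wq0)//.
  exact: mixture_ge.
rewrite (rE B mB) -EFinM lee_fin ler_wpM2r ?fine_ge0//.
have kln : k%:R <= ln c + s.
  rewrite -ler_expR expRD lnK// -Eexp; exact: ek.
have kb : k.+1%:R ^+ b <= eta^-1 ^+ b * (expR (de / 2) * expR (de / 2 * k%:R)).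
  apply: (@le_trans _ _ ((eta^-1 * expR (eta * k.+1%:R)) ^+ b)).
    apply: lerXn2r; rewrite ?nnegrE ?mulr_ge0 ?invr_ge0 ?expR_ge0 ?(ltW eta0)//.
    rewrite mulrC ler_pdivlMr// mulrC.
    by apply: (le_trans _ (expR_ge1Dx _)); rewrite lerDr.
  rewrite exprMn ler_wpM2l ?exprn_ge0 ?invr_ge0 ?(ltW eta0)//.
  rewrite -expRD -expRM_natl ler_expR.
  have -> : de / 2 + de / 2 * k%:R = de / 2 * k.+1%:R by rewrite -natr1; ring.
  rewrite mulrA ler_wpM2r// /eta mulrCA ger_pMr ?divr_gt0//.
  by rewrite ler_pdivrMr// mul1r ler_nat.
have qk : q ^- k = expR (de / 2 * k%:R).
  by rewrite /q -expRM_natl mulrN expRN invrK mulrC.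
have -> : K / W = #|Ix k|%:R * K * q ^- k / (1 - q).
  by rewrite /W; field; rewrite !gt_eqF ?subr_gt0// exprn_gt0.
have c10 : 0 < c1.
  by rewrite /c1 !mulr_gt0 ?invr_gt0 ?subr_gt0 ?exprn_gt0 ?expR_gt0 ?invr_gt0.
apply: (@le_trans _ _ (expR (ln c1 + (a%:R + de) * s))); last first.
  rewrite ler_expR lerD2r ler_ln ?posrE ?lt_max ?ltr01//.
  by rewrite le_max lexx orbT.
rewrite expRD lnK ?posrE// mulrDl expRD expRM_natl -Eexp qk.
have ek2 : expR (de / 2 * k%:R) * expR (de / 2 * k%:R) <=
    expR (de * ln c) * expR (de * s).
  rewrite -!expRD ler_expR.
  have -> : de / 2 * k%:R + de / 2 * k%:R = de * k%:R by field.
  by rewrite -mulrDr ler_pM2l.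
set X := (1 + energy x) ^+ a; have X0 : 0 <= X by rewrite exprn_ge0// ltW.
have [E0 q1'] : 0 <= expR (de / 2 * k%:R) /\ 0 < 1 - q.
  by rewrite expR_ge0 subr_gt0.
rewrite ler_pdivrMr//.
apply: (@le_trans _ _ (c * (eta^-1 ^+ b * (expR (de / 2) * expR (de / 2 * k%:R))) * X *
    expR (de / 2 * k%:R))).
  rewrite ler_wpM2r// (le_trans IK)// ler_wpM2r// ler_wpM2l//.
  exact: ltW.
have -> : c1 * (X * expR (de * s)) * (1 - q) =
  c * eta^-1 ^+ b * expR (de / 2) * X *
    (expR (de * ln c) * expR (de * s)).
  by rewrite /c1; field; rewrite gt_eqF.
have -> : c * (eta^-1 ^+ b * (expR (de / 2) * expR (de / 2 * k%:R))) * X *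
    expR (de / 2 * k%:R) = c * eta^-1 ^+ b * expR (de / 2) * X *
    (expR (de / 2 * k%:R) * expR (de / 2 * k%:R)) by ring.
apply: ler_wpM2l => //;
  rewrite !mulr_ge0 ?exprn_ge0 ?expR_ge0 ?invr_ge0 ?(ltW eta0)//;
exact: ltW.
Qed.

End mixture.

(** * Conditioning on the input *)

Definition law d1 d2 (T1 : measurableType d1) (T2 : measurableType d2) (R :
  realType)
    (P : probability T1 R) (f : T1 -> T2) (mf : measurable_fun setT f) :
    probability T2 R :=
  distribution P (HB.pack_for {mfun T1 >-> T2} f (isMeasurableFun.Build _ _ _ _ f mf)).

Section independence.
Context {d : measure_display} {T : measurableType d} {R : realType}.
Variables (P : probability T R) (J : Type) (I : finType).
Variables (X : J -> T -> R) (Z : I -> T -> R).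
Hypotheses (mX : forall j, measurable_fun setT (X j))
  (mZ : forall i, measurable_fun setT (Z i)).
Local Notation gam := (normal_prob 0 (Num.sqrt (2^-1 : R))).
Hypothesis indepXZ : forall (A : set T) (B : I -> set R), gen_sigma X A ->
  (forall i, measurable (B i)) ->
  P (A `&` [set t | forall i, B i (Z i t)]) = (P A * \prod_i gam (B i))%E.

Let Xv (t : T) : vec R J := X^~ t.
Let Zv (t : T) : vec R I := Z^~ t.

Lemma measurable_Xv : measurable_fun setT Xv.
Proof. exact: measurable_vecP. Qed.

Lemma measurable_Zv : measurable_fun setT Zv.
Proof. exact: measurable_vecP. Qed.

Let muX := law P measurable_Xv.
Let muZ := law P measurable_Zv.

Lemma gen_sigmaT : gen_sigma X setT.
Proof. by rewrite gen_sigmaE; exists setT => //; rewrite setTI. Qed.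

Lemma gaussian_law : gaussian muZ.
Proof.
move=> B mB; have := indepXZ gen_sigmaT mB.
by rewrite setTI probability_setT mul1e.
Qed.

Lemma measurable_XZ : measurable_fun setT (fun t => (Xv t, Zv t)).
Proof.
by apply: measurable_fun_pair; [exact: measurable_Xv|exact: measurable_Zv].
Qed.

(** For a fixed input event, [P] restricted to it and projected on the noise agrees on boxes with a
    multiple of the Gaussian law; rectangles then determine the joint law. *)
Lemma law_XZ (E : set (vec R J * vec R I)) : measurable E ->
  (muX \x muZ)%E E = P ((fun t => (Xv t, Zv t)) @^-1` E).
Proof.
move=> mE.
apply: (@product_measure_unique _ _ _ _ R muX muZ (image_measure P measurable_XZ)) => //.
move=> A B mA mB.
have sA : gen_sigma X (Xv @^-1` A) by rewrite gen_sigmaE; exists A => //;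
  rewrite setTI.
have mA' : measurable (Xv @^-1` A).
  by rewrite -[X in measurable X]setTI; exact: measurable_Xv.
have PA0 : 0 <= fine (P (Xv @^-1` A)) by rewrite fine_ge0.
have PAE : P (Xv @^-1` A) = (fine (P (Xv @^-1` A)))%:E.
  by rewrite fineK// fin_num_measure.
pose m1 := image_measure (mrestr P mA') measurable_Zv.
pose m2 := mscale (NngNum PA0) muZ.
have h : forall B, measurable B -> m1 B = m2 B.
  apply: box_measure_unique => [|C mC].
    apply: (@le_lt_trans _ _ 1%E); last exact: ltry.
    apply: probability_le1; apply: measurableI => //.
    by rewrite -[X in measurable X]setTI; exact: measurable_Zv.
  transitivity (P (Xv @^-1` A `&` [set t | forall i, C i (Z i t)])).
    by rewrite setIC.
  rewrite indepXZ//; transitivity ((fine (P (Xv @^-1` A)))%:E * muZ (box C))%E => //.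
  by rewrite -PAE; congr (_ * _)%E; exact/esym/gaussian_law.
transitivity (m1 B).
  by transitivity (P (Xv @^-1` A `&` Zv @^-1` B)) => //; rewrite setIC.
rewrite h//; transitivity ((fine (P (Xv @^-1` A)))%:E * muZ B)%E => //.
by rewrite -PAE.
Qed.

Lemma integral_XZ (f : vec R J * vec R I -> \bar R) :
  measurable_fun setT f -> (forall z, 0 <= f z)%E ->
  (\int[P]_t f (Xv t, Zv t) = \int[muX]_u \int[muZ]_v f (u, v))%E.
Proof.
move=> mf f0; rewrite -(@fubini_tonelli1 _ _ _ _ _ muX muZ f mf f0).
transitivity (\int[image_measure P measurable_XZ]_z f z)%E.
  by rewrite ge0_integral_pushforward//; exact: measurable_XZ.
by apply: eq_measure_integral => E mE _; exact/esym/law_XZ.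
Qed.

(** By Fubini for the product law: for a fixed input [u] the inner integral obeys the kernel bound,
    whose factor [expR (h u)] is cancelled by [expR (- h u)]. The conclusion is the form required by
    [mutual_info_le]. *)
Lemma integral_kernel_le d' (O : measurableType d') (Phi : vec R J * vec R I -> O)
    (h : vec R J -> R) (r : R) (A : set (vec R J)) (B : set O) :
  measurable_fun setT Phi -> measurable_fun setT h -> 0 <= r ->
  measurable A -> measurable B ->
  (forall u, muZ ((fun v => Phi (u, v)) @^-1` B) <= (expR (h u) * r)%:E)%E ->
  (\int[P]_(t in Xv @^-1` A `&` (fun t => Phi (Xv t, Zv t)) @^-1` B)
     (expR (- h (Xv t)))%:E <= P (Xv @^-1` A) * r%:E)%E.
Proof.
move=> mPhi mh r0 mA mB hB.
pose f (z : vec R J * vec R I) : \bar R :=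
  ((expR (- h z.1) * \1_A z.1)%:E * (\1_B (Phi z))%:E)%E.
have mf : measurable_fun setT f.
  apply: emeasurable_funM; apply/measurable_EFinP.
    apply: measurable_funM.
      apply: measurableT_comp => //; apply: measurableT_comp => //.
      exact: measurableT_comp.
    by apply: measurableT_comp => //; exact: measurable_indic.
  by apply: measurableT_comp => //; exact: measurable_indic.
have f0 z : (0 <= f z)%E by rewrite mule_ge0// lee_fin ?mulr_ge0// expR_ge0.
have -> : (\int[P]_(t in Xv @^-1` A `&` (fun t => Phi (Xv t, Zv t)) @^-1` B)
     (expR (- h (Xv t)))%:E = \int[P]_t f (Xv t, Zv t))%E.
  rewrite integral_mkcond; apply: eq_integral => t _.
  rewrite /patch /f /= !indicE -EFinM.
  case: ifPn; first by rewrite inE /= => -[At Bt]; rewrite !mem_set// !mulr1.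
  rewrite notin_setE /= => /not_andP[]nt.
    by rewrite [_ \in A]memNset// mulr0 mul0r.
  by rewrite [_ \in B]memNset// mulr0.
rewrite integral_XZ//.
apply: (@le_trans _ _ (\int[muX]_u (r%:E * (\1_A u)%:E))%E).
  apply: ge0_le_integral => //.
  - by move=> u _; apply: integral_ge0 => v _.
  - by apply: (@measurable_fun_fubini_tonelli_F _ _ _ _ _ muZ f).
  - apply: measurable_funeM; apply/measurable_EFinP; exact: measurable_indic.
  move=> u _; rewrite /f /=.
  have mBu : measurable ((fun v => Phi (u, v)) @^-1` B).
    rewrite -[X in measurable X]setTI; apply: (measurable_fun_pair2 u mPhi) => //.
  have e0 : (0 <= (expR (- h u) * \1_A u)%:E)%E by rewrite lee_fin mulr_ge0// expR_ge0.
  have mBi : measurable_fun setT (fun v => (\1_B (Phi (u, v)) : R)%:E).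
    by apply/measurable_EFinP; exact: (@measurable_indic _ _ R setT _ mBu).
  have Bi0 v : (0 <= (\1_B (Phi (u, v)) : R)%:E)%E by rewrite lee_fin.
  rewrite (ge0_integralZl muZ measurableT mBi (fun v _ => Bi0 v) e0).
  have -> : (\int[muZ]_v (\1_B (Phi (u, v)))%:E =
      muZ ((fun v => Phi (u, v)) @^-1` B))%E.
    transitivity (\int[muZ]_v (\1_((fun v => Phi (u, v)) @^-1` B) v)%:E)%E => //.
    by rewrite integral_indic// setIT.
  apply: (@le_trans _ _ ((expR (- h u) * \1_A u)%:E * (expR (h u) * r)%:E)%E).
    by apply: lee_wpmul2l; rewrite ?lee_fin ?mulr_ge0 ?expR_ge0.
  rewrite -!EFinM lee_fin mulrACA [\1_A u * r]mulrC -expRD addNr expR0 mul1r.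
  exact: lexx.
rewrite ge0_integralZl ?integral_indic ?setIT//; last first.
  by apply/measurable_EFinP; exact: measurable_indic.
by rewrite muleC.
Qed.

End independence.

(** * The capacity *)

Section capacity_bound.
Context {R : realType}.
Local Notation C := R[i].

Definition cmeas d (T : measurableType d) (f : T -> C) :=
  forall b, measurable_fun setT (fun t => cpart b (f t)).

Lemma cmeasD d (T : measurableType d) (f g : T -> C) :
  cmeas f -> cmeas g -> cmeas (fun t => f t + g t).
Proof.
move=> mf mg b; under eq_fun do rewrite cpartD.
exact: measurable_funD.
Qed.

Lemma cmeasM d (T : measurableType d) (f g : T -> C) :
  cmeas f -> cmeas g -> cmeas (fun t => f t * g t).
Proof.
move=> mf mg; have := (mf true, mf false, mg true, mg false).
move=> /= [[[f1 f2] g1] g2] [] /=.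
  rewrite (_ : (fun _ => _) = fun t => cpart true (f t) * cpart true (g t) -
    cpart false (f t) * cpart false (g t)).
    by apply: measurable_funB; exact: measurable_funM.
  by apply/funext => t; case: (f t) => ? ?; case: (g t).
rewrite (_ : (fun _ => _) = fun t => cpart true (f t) * cpart false (g t) +
  cpart false (f t) * cpart true (g t)).
  by apply: measurable_funD; exact: measurable_funM.
by apply/funext => t; case: (f t) => ? ?; case: (g t).
Qed.

Lemma cmeas_cst d (T : measurableType d) (z : C) : cmeas (fun _ : T => z).
Proof. by move=> b. Qed.

Lemma cmeas_sum d (T : measurableType d) (J : Type) (r : seq J) (f :
  J -> T -> C) :
  (forall j, cmeas (f j)) -> cmeas (fun t => \sum_(j <- r) f j t).
Proof.
move=> mf; elim: r => [|j r IH].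
  by under [X in cmeas X]eq_fun do rewrite big_nil; exact: cmeas_cst.
by under [X in cmeas X]eq_fun do rewrite big_cons; exact: cmeasD.
Qed.

Lemma cmeas_complex d (T : measurableType d) (f g : T -> R) :
  measurable_fun setT f -> measurable_fun setT g ->
  cmeas (fun t => Complex (f t) (g t)).
Proof. by move=> mf mg []. Qed.

Section channel_law.
Context {N M Q : nat}.
Local Notation I := ((('I_M * 'I_Q) * bool) + (('I_M * 'I_N) * bool))%type.
Local Notation J := ('I_N * bool)%type.
Local Notation O := (('I_M * 'I_N) * bool)%type.

Definition xrow (u : vec R J) : 'rV[C]_N :=
  \row_n Complex (u (n, true)) (u (n, false)).

Lemma chanE (Pm : 'M[C]_(N, Q)) x (v : vec R I) m n b :
  chan Pm x v (m, n, b) =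
  cpart b ((\sum_q Smx v m q * Pm n q) * x 0 n + Wmx v m n).
Proof.
rewrite /chan /lout /outv /= mulmx1 mulmxA mxE mul_mx_diagE mxE.
by congr (cpart _ (_ * _ + _)); apply: eq_bigr => q _; rewrite [Pm^T _ _]mxE.
Qed.

Lemma measurable_chan (Pm : 'M[C]_(N, Q)) :
  measurable_fun setT (fun z :
    vec R J * vec R I => chan (M := M) Pm (xrow z.1) z.2).
Proof.
have m1 j : measurable_fun setT (fun z : vec R J * vec R I => z.1 j).
  exact: (measurableT_comp (@measurable_coord R J j) measurable_fst).
have m2 i : measurable_fun setT (fun z : vec R J * vec R I => z.2 i).
  exact: (measurableT_comp (@measurable_coord R I i) measurable_snd).
have mS m q : cmeas (fun z : vec R J * vec R I => Smx z.2 m q).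
  rewrite (_ : (fun _ => _) = fun z : vec R J * vec R I =>
    Complex (z.2 (inl (m, q, true))) (z.2 (inl (m, q, false)))).
    exact: cmeas_complex.
  by apply/funext => z; rewrite mxE.
have mW m n : cmeas (fun z : vec R J * vec R I => Wmx z.2 m n).
  rewrite (_ : (fun _ => _) = fun z : vec R J * vec R I =>
    Complex (z.2 (inr (m, n, true))) (z.2 (inr (m, n, false)))).
    exact: cmeas_complex.
  by apply/funext => z; rewrite mxE.
have mx n : cmeas (fun z : vec R J * vec R I => xrow z.1 0 n).
  rewrite (_ : (fun _ => _) = fun z : vec R J * vec R I =>
    Complex (z.1 (n, true)) (z.1 (n, false))).
    exact: cmeas_complex.
  by apply/funext => z; rewrite mxE.
apply: measurable_vecP => -[[m n] b].
rewrite [X in measurable_fun _ X](_ : _ = fun z : vec R J * vec R I =>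
  cpart b ((\sum_q Smx z.2 m q * Pm n q) * xrow z.1 0 n + Wmx z.2 m n));
    last first.
  by apply/funext => z; rewrite chanE.
apply: cmeasD => //; apply: cmeasM => //; apply: cmeas_sum => q.
by apply: cmeasM => //; exact: cmeas_cst.
Qed.

Definition noise (T : Type) (Sr Si : 'I_M -> 'I_Q -> T -> R)
    (Wr Wi : 'I_M -> 'I_N -> T -> R) (l : I) : T -> R :=
  match l with
  | inl (mq, b) => if b then Sr mq.1 mq.2 else Si mq.1 mq.2
  | inr (mn, b) => if b then Wr mn.1 mn.2 else Wi mn.1 mn.2
  end.

Lemma channel_outputE (T : Type) (Pm : 'M[C]_(N, Q)) (xr xi : 'I_N -> T -> R)
    Sr Si Wr Wi (t : T) (mnb : O) :
  (let y := channel_output Pm xr xi Sr Si Wr Wi mnb.1.1 mnb.1.2 t in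
   if mnb.2 then complex.Re y else complex.Im y) =
  chan Pm (xrow (fun nb : J => (if nb.2 then xr nb.1 else xi nb.1) t))
    (fun l => noise Sr Si Wr Wi l t) mnb.
Proof.
case: mnb => [[m n] b]; rewrite chanE /channel_output /= /cpart !mxE /=.
by under [in RHS]eq_bigr do rewrite mxE /=.
Qed.

Lemma energy_xrow (T : Type) (xr xi : 'I_N -> T -> R) (t : T) :
  energy (xrow (fun nb : J => (if nb.2 then xr nb.1 else xi nb.1) t)) =
  \sum_(n < N) (xr n t ^+ 2 + xi n t ^+ 2).
Proof. by apply: eq_bigr => n _; rewrite sqr_normc mxE. Qed.

Lemma big_option (F : option I -> \bar R) :
  (\prod_(k : option I) F k = F None * \prod_(i : I) F (Some i))%E.
Proof.
rewrite (bigD1 None)//=; congr (_ * _)%E.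
rewrite (reindex_omap Some id) => [|[i|]//].
by apply: eq_bigl => i; rewrite /= eqxx.
Qed.

(** Disjoint events may come from sets that overlap outside the range of [Y]; removing the earlier
    sets from each one changes no preimage. Disjointness is needed to add masses under the reference
    subprobability. *)
Lemma disjointify l (B : 'I_l -> set (vec R O)) (T : Type) (Y : T -> vec R O)
    (Bt : 'I_l -> set T) :
  (forall j, measurable (B j)) -> (forall j, Bt j = Y @^-1` B j) ->
  (forall i j, i != j -> Bt i `&` Bt j = set0) ->
  exists B' : 'I_l -> set (vec R O), [/\ forall j, measurable (B' j),
    forall i j, i != j -> B' i `&` B' j = set0 & forall j, Bt j = Y @^-1` B' j].
Proof.
move=> mB BtE dB.
exists (fun j => B j `\` \big[setU/set0]_(i < l | (i < j)%N) B i); split.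
- by move=> j; apply: measurableD => //; apply: bigsetU_measurable.
- suff h (i j : 'I_l) : (i < j)%N ->
      (B i `\` \big[setU/set0]_(k < l | (k < i)%N) B k) `&`
      (B j `\` \big[setU/set0]_(k < l | (k < j)%N) B k) = set0.
    move=> i j; rewrite neq_ltn => /orP[|ji]; first exact: h.
    by rewrite setIC h.
  move=> ij; apply/seteqP; split => v //= [[Bi _] [_]]; apply.
  by rewrite -bigcup_seq_cond; exists i => //=; rewrite mem_index_enum.
move=> j; rewrite BtE; apply/seteqP; split => t /=; last by case.
move=> Bj; split => //; rewrite -bigcup_seq_cond => -[i /= /andP[_ ij] Bi].
have : (Bt i `&` Bt j) t by rewrite !BtE.
by rewrite dB// neq_ltn ij.
Qed.

End channel_law.

Lemma mutual_info_channel_le (N M Q : nat) (Pm : 'M[C]_(N, Q)) (a : nat) (de :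
  R) :
  covered (M := M) Pm a -> 0 < de -> exists2 c : R, 1 <= c &
  forall (rho : R) (d : measure_display) (T : measurableType d) (P :
    probability T R)
    (xr xi : 'I_N -> T -> R) (Sr Si : 'I_M -> 'I_Q -> T -> R)
    (Wr Wi : 'I_M -> 'I_N -> T -> R), 0 < rho ->
  admissible rho P xr xi Sr Si Wr Wi ->
  (mutual_info P
     (gen_sigma (fun nb : 'I_N * bool => if nb.2 then xr nb.1 else xi nb.1))
     (gen_sigma (fun mnb : ('I_M * 'I_N) * bool => fun t =>
        let y := channel_output Pm xr xi Sr Si Wr Wi mnb.1.1 mnb.1.2 t in
        if mnb.2 then complex.Re y else complex.Im y)) <=
   (ln c + (a%:R + de) * ln (1 + N%:R * rho))%:E)%E.
Proof.
move=> cov de0; have [c c1 mix] := covered_mixture cov de0.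
exists c => // rho d T P xr xi Sr Si Wr Wi rho0 [mx hS hW ind en].
set X := (X in gen_sigma X) in ind *.
pose Z := noise Sr Si Wr Wi.
have hZ l : half_gauss P (Z l).
  case: l => [[mq b]|[mn b]]; rewrite /Z /=.
    by case: (hS mq.1 mq.2) => ? ?; case: b.
  by case: (hW mn.1 mn.2) => ? ?; case: b.
have mZ l : measurable_fun setT (Z l) by case: (hZ l).
have mX j : measurable_fun setT (X j).
  by rewrite /X; case: (mx j.1) => ? ?; case: (j.2).
have indXZ (A : set T) (B : _ -> set R) : gen_sigma X A ->
    (forall i, measurable (B i)) ->
    P (A `&` [set t | forall i, B i (Z i t)]) =
    (P A * \prod_i normal_prob 0 (Num.sqrt (2^-1 : R)) (B i))%E.
  move=> sA mB.
  have PZ l : P (Z l @^-1` B l) = normal_prob 0 (Num.sqrt (2^-1 : R)) (B l).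
    by case: (hZ l) => _; apply.
  (* One event per index: the input event at [None], an event of one noise coordinate elsewhere. *)
  pose D (k : indep_index N M Q) := if k is Some l then Z l @^-1` B l else A.
  have -> : A `&` [set t | forall i, B i (Z i t)] = \bigcap_(k in [set:
    indep_index N M Q]) D k.
    apply/seteqP; split => t /=.
      by move=> [At h] [i|] _ //=; exact: h.
    by move=> h; split; [exact: (h None)|move=> i; exact: (h (Some i))].
  rewrite ind; first by rewrite big_option /=; congr (_ * _)%E; exact: eq_bigr.
  move=> [[[mq b]|[mn b]]|] //=; rewrite gen_sigmaE.
    exists [set u : vec R unit | B (inl (mq, b)) (u tt)].
      by rewrite -[X in measurable X]setTI; apply: measurable_coord.
    by rewrite setTI.
  exists [set u : vec R unit | B (inr (mn, b)) (u tt)].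
    by rewrite -[X in measurable X]setTI; apply: measurable_coord.
  by rewrite setTI.
pose Xv (t : T) : vec R ('I_N * bool)%type := X^~ t.
pose Zv (t : T) : vec R _ := Z^~ t.
pose g := law P (measurable_Zv mZ).
have gg : gaussian g by exact: (gaussian_law mZ indXZ).
have [r [r0 r1 rB]] := mix g gg.
pose Phi (z : vec R ('I_N * bool)%type * vec R _) := chan (M :=
  M) Pm (xrow z.1) z.2.
pose Y (t : T) := Phi (Xv t, Zv t).
have mY : measurable_fun setT Y.
  apply: (measurableT_comp (measurable_chan Pm)).
  by apply: measurable_fun_pair; [exact: measurable_Xv|exact: measurable_Zv].
set F := gen_sigma X; set G := gen_sigma _.
have FE : F = preimage_set_system setT Xv measurable by rewrite /F gen_sigmaE.
have GE : G = preimage_set_system setT Y measurable.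
  rewrite /G gen_sigmaE; congr preimage_set_system; apply/funext => t.
  by apply/funext => mnb; exact: channel_outputE.
have mF : F `<=` measurable.
  by rewrite FE => _ [A mA <-]; apply: measurable_Xv.
have mG : G `<=` measurable by rewrite GE => _ [A mA <-]; exact: mY.
pose s0 := 1 + N%:R * rho.
have s01 : 1 <= s0 by rewrite /s0 lerDl mulr_ge0// ltW.
have s00 : 0 < s0 by exact: lt_le_trans s01.
(* [al + be * E] is the tangent at [E = N * rho] to the concave function
   [ln c + (a + de) * ln (1 + E)]: an affine majorant whose mean the power constraint controls,
   without loss at mean energy [N * rho]. *)
pose al := ln c + (a%:R + de) * (ln s0 + s0^-1 - 1).
pose be := (a%:R + de) / s0.
have ade : 0 <= a%:R + de by rewrite addr_ge0// ltW.
have be0 : 0 <= be by rewrite divr_ge0// ltW.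
have ln_tan (y : R) : 0 < y -> ln y <= y - 1.
  by move=> y0; have := @le_ln1Dx R (y - 1); rewrite addrCA subrr addr0; apply;
    lra.
have al0 : 0 <= al.
  rewrite addr_ge0 ?ln_ge0// mulr_ge0//.
  by have := ln_tan s0^-1; rewrite invr_gt0 lnV ?posrE// => /(_ s00); lra.
pose h (u : vec R ('I_N * bool)%type) := al + be * energy (xrow u).
have h0 u : 0 <= h u by rewrite addr_ge0// mulr_ge0// energy_ge0.
have hge u : ln c + (a%:R + de) * ln (1 + energy (xrow u)) <= h u.
  have e0 := energy_ge0 (xrow u).
  have s1 : 0 < 1 + energy (xrow u) by lra.
  rewrite /h /al /be -addrA lerD2l mulrAC -mulrA -mulrDr ler_wpM2l//.
  have := ln_tan ((1 + energy (xrow u)) / s0); rewrite divr_gt0// => /(_ isT).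
  by rewrite ln_div ?posrE// mulrDl div1r; lra.
pose s (t : T) := \sum_(n < N) (xr n t ^+ 2 + xi n t ^+ 2).
have hE t : h (Xv t) = al + be * s t.
  by rewrite /h /s -energy_xrow.
have mh : measurable_fun setT h.
  rewrite (_ : h = fun u =>
    al + be * \sum_n (u (n, true) ^+ 2 + u (n, false) ^+ 2)).
    apply: measurable_funD => //; apply: measurable_funM => //.
    apply: measurable_sum => n; apply: measurable_funD; apply: measurable_funX;
    exact: measurable_coord.
  apply/funext => u; rewrite /h; congr (_ + _ * _).
  by apply: eq_bigr => n _; rewrite sqr_normc mxE.
have mhX : measurable_fun setT (fun t => h (Xv t)).
  exact: (measurableT_comp mh (measurable_Xv mX)).
apply: (@le_trans _ _ (\int[P]_t (h (Xv t))%:E)%E).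
  apply: (mutual_info_le mF mG mhX (fun t => h0 (Xv t))) => l B pB.
  have /boolp.choice[B1 B1P] (j : 'I_l) : exists B' : set (vec R _),
      measurable B' /\ B j = Y @^-1` B'.
    have : G (B j) by case: pB.
    by rewrite GE => -[B' mB' <-]; exists B'; split=> //; rewrite setTI.
  have [|||B2 [mB2 dB2 B2E]] := @disjointify N M l B1 T Y B.
  - by move=> j; case: (B1P j).
  - by move=> j; case: (B1P j).
  - by case: pB.
  exists (fun j => r (B2 j)); split => //; first exact: r1.
  move=> A j; rewrite FE => -[A' mA' <-]; rewrite setTI B2E.
  apply: (@integral_kernel_le _ _ _ P _ _ X Z mX mZ indXZ _ _ Phi h) => //.
    exact: measurable_chan.
  move=> u; apply: (le_trans (rB (xrow u) (B2 j) (mB2 j))).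
  by rewrite lee_fin ler_wpM2r// ler_expR.
under eq_integral do rewrite hE EFinD EFinM.
have ms : measurable_fun setT s.
  apply: measurable_sum => n; case: (mx n) => m1 m2.
  by apply: measurable_funD; exact: measurable_funX.
have s0' t : 0 <= s t by apply: sumr_ge0 => n _; rewrite addr_ge0// sqr_ge0.
have ms' : measurable_fun setT (fun t => (s t)%:E) by exact/measurable_EFinP.
rewrite ge0_integralD//; last 2 first.
- by move=> t _; rewrite -EFinM lee_fin mulr_ge0.
- exact: measurable_funeM.
have Ial : (\int[P]_t al%:E = al%:E)%E.
  rewrite integral_cst// -[RHS]mule1; congr (_ * _)%E; exact: probability_setT.
have be0' : (0 <= be%:E)%E by rewrite lee_fin.
have s0'' t : setT t -> (0 <= (s t)%:E)%E by rewrite lee_fin.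
rewrite Ial (ge0_integralZl P measurableT ms' s0'' be0').
apply: (@le_trans _ _ (al%:E + be%:E * (N%:R * rho)%:E)%E).
  by rewrite leeD2l// lee_wpmul2l ?lee_fin.
rewrite -EFinM -EFinD lee_fin le_eqVlt; apply/orP; left; apply/eqP.
have -> : N%:R * rho = s0 - 1 by rewrite /s0 addrC addKr.
have -> : 1 + (s0 - 1) = s0 by rewrite addrC subrK.
by rewrite /al /be; field; rewrite gt_eqF.
Qed.

Lemma capacity_le (N M Q : nat) (Pm : 'M[C]_(N, Q)) (a : nat) (e : R) :
  (0 < N)%N -> covered (M := M) Pm a -> 0 < e ->
  exists r0 : R, forall rho : R, r0 < rho ->
  (capacity M Pm rho * ((ln rho)^-1)%:E <= (a%:R / N%:R + e)%:E)%E.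
Proof.
move=> N0 cov e0.
have N0' : 0 < N%:R :> R by rewrite ltr0n.
have N1 : 1 <= N%:R :> R by rewrite ler1n.
(* After division by [N], [de] contributes [e / 2]; the other [e / 2] absorbs the constant [D] once
   [ln rho] exceeds [D / de]. *)
pose de := N%:R * e / 2.
have de0 : 0 < de by rewrite divr_gt0// mulr_gt0.
have [c c1 bound] := mutual_info_channel_le cov de0.
have ade : 0 <= a%:R + de by rewrite addr_ge0// ltW.
(* The factor [2 * N] comes from [1 + N * rho <= 2 * N * rho], valid as [rho > 1]. *)
pose D := ln c + (a%:R + de) * ln (2 * N%:R).
have D0 : 0 <= D.
  by rewrite addr_ge0 ?ln_ge0// mulr_ge0// ln_ge0// -[leLHS]mulr1 ler_pM// ler1n.
exists (expR (D / de)) => rho hrho.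
have rho1 : 1 < rho.
  by apply: le_lt_trans hrho; rewrite -[leLHS]expR0 ler_expR divr_ge0// ltW.
have rho0 : 0 < rho by exact: lt_trans rho1.
have lnr : D / de < ln rho by rewrite -ltr_expR lnK.
have lr0 : 0 < ln rho by rewrite ln_gt0.
rewrite /capacity; set S := ereal_sup _.
pose B := ln c + (a%:R + de) * ln (1 + N%:R * rho).
have SB : (S <= B%:E)%E.
  apply: ge_ereal_sup => _ [d [T [P [xr [xi [Sr [Si [Wr [Wi [adm ->]]]]]]]]]].
  exact: bound.
apply: (@le_trans _ _ ((N%:R^-1)%:E * B%:E * ((ln rho)^-1)%:E)%E).
  apply: lee_wpmul2r; first by rewrite lee_fin invr_ge0 ltW.
  by apply: lee_wpmul2l; first by rewrite lee_fin invr_ge0.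
rewrite -!EFinM lee_fin ler_pdivrMr// mulrC ler_pdivrMr//.
have -> : (a%:R / N%:R + e) * ln rho * N%:R = (a%:R + de) * ln rho + de * ln rho.
  by rewrite /de; field; rewrite gt_eqF.
have BD : B <= D + (a%:R + de) * ln rho.
  rewrite /B /D -addrA lerD2l -mulrDr ler_wpM2l//.
  rewrite -lnM ?posrE ?mulr_gt0// ler_ln ?posrE ?mulr_gt0//; last first.
    by rewrite addr_gt0// mulr_gt0.
  have : 1 <= N%:R * rho by rewrite -[leLHS]mulr1 ler_pM// ltW.
  by rewrite -mulrA; lra.
apply: (le_trans BD); rewrite addrC lerD2l mulrC.
by apply/ltW; rewrite -ltr_pdivrMr.
Qed.

End capacity_bound.

Theorem theorem2 (R : realType) (N M Q : nat) (Pm : 'M[R[i]]_(N, Q)) :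
  (1 <= N)%N -> (1 <= M)%N -> (1 <= Q <= N)%N ->
  \rank Pm = Q ->
  (forall n : 'I_N, \sum_(q < Q) `|Pm n q| ^+ 2 = 1) ->
  (* limsup_{rho -> +oo} C(rho) / ln rho <= min{M (1 - Q/N), 1 - 1/N} *)
  forall e : R, 0 < e -> exists r0 : R, forall rho : R, r0 < rho ->
    (capacity M Pm rho * ((ln rho)^-1)%:E
       <= (Num.min (M%:R * (1 - Q%:R / N%:R)) (1 - N%:R^-1) + e)%:E)%E.
Proof.
move=> N1 M1 /andP[Q1 QN] rkP _ e e0.
have n0 : N%:R != 0 :> R by rewrite pnatr_eq0 -lt0n.
(* Only the smaller of the two bounds has to be proved, and each is an integer exponent divided by
   [N]. *)
have [_|_] := leP (M%:R * (1 - Q%:R / N%:R) : R) (1 - N%:R^-1).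
  have -> : M%:R * (1 - Q%:R / N%:R) = (M * (N - Q))%:R / N%:R :> R.
    by rewrite natrM natrB//; field.
  exact: (capacity_le N1 (covered_block M rkP) e0).
have -> : 1 - N%:R^-1 = N.-1%:R / N%:R :> R.
  by rewrite -subn1 natrB//; field.
exact: (capacity_le N1 (covered_pred M Pm N1) e0).
Qed.
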